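(* Let $G$ be a finite simple graph that contains no theta, no wheel and no pyramid as an induced subgraph. Then $G$ is the line graph of a triangle-free chordless graph, or $G$ admits a clique cutset.
   Context: A hole is a chordless cycle of length at least 4. A prism consists of three node-disjoint chordless paths $a_1\dots b_1$, $a_2\dots b_2$, $a_3\dots b_3$, each of length at least 1, such that $a_1a_2a_3$ and $b_1b_2b_3$ are triangles and there are no edges between the paths other than those of the two triangles. A pyramid consists of three chordless paths $a\dots b_1$, $a\dots b_2$, $a\dots b_3$ of length at least 1, at least two of length at least 2, pairwise node-disjoint except at $a$, such that $b_1b_2b_3$ is a triangle and there are no edges between the paths other than those of the triangle and the three edges incident to $a$. A theta consists of three internally node-disjoint chordless paths between two nodes $a,b$, each of length at least 2, with no edges between the paths other than the three edges at $a$ and the three edges at $b$. A wheel is a hole $H$ together with a node $c\notin V(H)$ having at least three neighbors in $H$. ''Contains'' means ''has an induced subgraph isomorphic to''. A graph is chordless if every cycle of it is chordless (has no chord). A clique cutset is a set $S$ of nodes inducing a clique (possibly empty) such that $G\setminus S$ is disconnected; in particular a disconnected graph has a clique cutset. The line graph $L(R)$ of $R$ has the edges of $R$ as nodes, two being adjacent when they share an end. *)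

(* Defs.v *)
From mathcomp Require Import all_boot.

Set Implicit Arguments.
Unset Strict Implicit.
Unset Printing Implicit Defensive.

Record sgraph := SGraph {
  vertex :> finType;
  adj : rel vertex;
  adj_sym : symmetric adj;
  adj_irrefl : irreflexive adj }.

Arguments adj {s}.

Definition isomorphic (G H : sgraph) : Prop :=
  exists2 f : G -> H, bijective f & forall x y, adj (f x) (f y) = adj x y.

Section Induced.
Variables (G : sgraph) (A : {set G}).

Definition induced_adj : rel {x : G | x \in A} :=
  fun x y => adj (val x) (val y).

Lemma induced_adj_sym : symmetric induced_adj.
Proof. by move=> x y; rewrite /induced_adj adj_sym. Qed.

Lemma induced_adj_irrefl : irreflexive induced_adj.
Proof. by move=> x; rewrite /induced_adj adj_irrefl. Qed.

Definition induced : sgraph := SGraph induced_adj_sym induced_adj_irrefl.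

End Induced.

Definition contains (G H : sgraph) : Prop :=
  exists A : {set G}, isomorphic (induced A) H.

Definition free_of (C : sgraph -> Prop) (G : sgraph) : Prop :=
  forall H : sgraph, C H -> ~ contains G H.

Section Configurations.
Variable G : sgraph.

(* The path with node sequence x :: p, hence of length size p. *)
Definition chordless_path (x : G) (p : seq G) (y : G) : Prop :=
  [/\ path adj x p, last x p = y, uniq (x :: p)
    & forall u v, u \in x :: p -> v \in x :: p -> adj u v ->
        index v (x :: p) = (index u (x :: p)).+1 \/
        index u (x :: p) = (index v (x :: p)).+1].

Definition is_cycle (c : seq G) : Prop :=
  [/\ 2 < size c, uniq c & cycle adj c].

Definition has_chord (c : seq G) : Prop :=
  exists u v, [/\ u \in c, v \in c, adj u v, v != next c u & u != next c v].

Definition is_hole (c : seq G) : Prop :=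
  [/\ is_cycle c, 3 < size c & ~ has_chord c].

Definition triangle (x y z : G) : Prop := [/\ adj x y, adj y z & adj x z].

(* For an edge between two of the paths with an end in {a, b}: a and b lie on
   all three paths, which are chordless, so the edge is the first or the last
   edge of one of them. *)
Definition is_theta : Prop :=
  exists (a b : G) (p : 'I_3 -> seq G),
    [/\ forall i, chordless_path a (p i) b,
        forall i, 1 < size (p i),
        forall i j, i != j -> forall x,
          x \in a :: p i -> x \in a :: p j -> x = a \/ x = b,
        forall i j, i != j -> forall x y,
          x \in a :: p i -> y \in a :: p j -> adj x y ->
          [\/ x = a, x = b, y = a | y = b]
      & forall x, exists i, x \in a :: p i].

(* As in is_theta, an edge between two of the paths with end a is the first
   edge of one of them. *)
Definition is_pyramid : Prop :=
  exists (a : G) (b : 'I_3 -> G) (p : 'I_3 -> seq G),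
    [/\ (forall i, chordless_path a (p i) (b i)) /\
          triangle (b (inord 0)) (b (inord 1)) (b (inord 2)),
        (forall i, 0 < size (p i)) /\ 1 < #|[set i | 1 < size (p i)]|,
        forall i j, i != j -> forall x,
          x \in a :: p i -> x \in a :: p j -> x = a,
        forall i j, i != j -> forall x y,
          x \in a :: p i -> y \in a :: p j -> adj x y ->
          [\/ x = a, y = a | x = b i /\ y = b j]
      & forall x, exists i, x \in a :: p i].

Definition is_wheel : Prop :=
  exists (c : G) (h : seq G),
    [/\ is_hole h, c \notin h, 2 < #|[set x in h | adj c x]|
      & forall x, x = c \/ x \in h].

Definition triangle_free : Prop := forall x y z : G, ~ triangle x y z.

Definition chordless_graph : Prop :=
  forall c : seq G, is_cycle c -> ~ has_chord c.

Definition clique (S : {set G}) : Prop :=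
  forall x y, x \in S -> y \in S -> x != y -> adj x y.

Definition disconnected : Prop := exists x y : G, ~~ connect adj x y.

Definition edges : {set {set G}} :=
  [set e : {set G} | [exists x : G, exists y : G, adj x y && (e == [set x; y])]].

End Configurations.

Definition clique_cutset (G : sgraph) (S : {set G}) : Prop :=
  clique S /\ disconnected (induced (~: S)).

Section LineGraph.
Variable R : sgraph.

Definition line_adj : rel {e : {set R} | e \in edges R} :=
  fun e f => (e != f) && (val e :&: val f != set0).

Lemma line_adj_sym : symmetric line_adj.
Proof. by move=> e f; rewrite /line_adj eq_sym setIC. Qed.

Lemma line_adj_irrefl : irreflexive line_adj.
Proof. by move=> e; rewrite /line_adj eqxx. Qed.

Definition line_graph : sgraph := SGraph line_adj_sym line_adj_irrefl.

End LineGraph.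

(* Main.v *)
(* Suppose that G has no theta, wheel or pyramid, and no clique cutset. If two
   nonadjacent vertices are complete to a maximal clique of size at least 2, a
   shortest path between such vertices outside the clique gives a wheel; so G
   has no diamond, and the neighbourhood of each vertex v splits into disjoint
   cliques. A vertex outside a hole cannot have two nonadjacent neighbours in
   it: with two neighbours there is a theta, with more a wheel. Hence each of
   the cliques around v attaches to a single component of the graph far from v,
   and connectivity of G minus a clique makes that component the same for all
   of them. If v were the centre of a claw, three paths through this component
   would form with v a theta or a pyramid. So G is claw-free and diamond-free:
   each vertex lies in at most two maximal cliques, two maximal cliques share at
   most one vertex, and G is the line graph of the graph whose vertices are the
   maximal cliques, with pendant vertices added. A chord of a cycle there would
   be the centre of a wheel in G. *)

From mathcomp Require Import all_boot.
Require Import Defs.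

Set Implicit Arguments.
Unset Strict Implicit.
Unset Printing Implicit Defensive.

(** * Splitting a sequence, or a path, at the boundary of a predicate *)

Lemma split_first (T : eqType) (a : pred T) s : has a s ->
  exists s1 x s2, [/\ s = s1 ++ x :: s2, a x & ~~ has a s1].
Proof.
elim: s => //= x s IH; have [ax _|nax /= /IH[s1 [y [s2 [-> ay ns1]]]]] := boolP (a x).
  by exists [::], x, s.
by exists (x :: s1), y, s2; rewrite /= negb_or nax.
Qed.

Lemma split_last (T : eqType) (a : pred T) s : has a s ->
  exists s1 x s2, [/\ s = s1 ++ x :: s2, a x & ~~ has a s2].
Proof.
rewrite -has_rev => /split_first[s1 [x [s2 [E ax ns1]]]].
exists (rev s2), x, (rev s1); rewrite has_rev; split=> //.
by rewrite -[s]revK E rev_cat rev_cons cat_rcons.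
Qed.

Lemma path_exit (T : eqType) (e : rel T) (P : pred T) x p :
  path e x p -> P x -> ~~ P (last x p) ->
  exists u w, [/\ u \in x :: p, w \in p, P u, ~~ P w & e u w].
Proof.
elim: p x => [|y p IH] x /=; first by move=> _ ->.
case/andP=> xy py Px nPl; have [Py|nPy] := boolP (P y).
  have [u [w [up wp Pu nPw uw]]] := IH y py Py nPl.
  by exists u, w; split=> //; rewrite inE ?up ?wp orbT.
by exists x, y; rewrite !mem_head.
Qed.

(** * Induced paths as a boolean predicate on sequences *)

Section InducedPaths.
Variable G : sgraph.
Implicit Types (x y z u v w : G) (s t : seq G).

(** Induced paths in recursive form: each vertex is adjacent, among the later ones, exactly to the
    next. The default [u] of [head] is never returned, since [u] ranges over [s']. Empty and
    one-vertex sequences count as paths. *)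
Fixpoint ipath s : bool :=
  if s is x :: s' then
    [&& ipath s', x \notin s' & all (fun u => adj x u == (u == head u s')) s']
  else true.

Lemma ipath_consP x s :
  reflect [/\ ipath s, x \notin s & {in s, forall u, adj x u = (u == head u s)}]
          (ipath (x :: s)).
Proof.
apply: (iffP and3P) => [] [ips xs xA]; split=> //.
  by move=> u us; apply/eqP/(allP xA).
by apply/allP=> u us; apply/eqP/xA.
Qed.

(** Two induced paths glue to one when they are disjoint and the only edge between them joins the
    last vertex of [s] to the first of [t]. The defaults of [last] and [head] are harmless, as both
    sequences are nonempty where they are read. *)
Lemma ipath_catP s t :
  reflect [/\ ipath s, ipath t &
             {in s & t, forall x y,
               x != y /\ adj x y = (x == last x s) && (y == head y t)}]
          (ipath (s ++ t)).
Proof.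
apply: (iffP idP) => [|[]]; elim: s => [|x s IH] //=.
- move=> /ipath_consP[/IH[ips ipt H]]; rewrite mem_cat negb_or.
  case/andP=> xs xt xA; split=> //.
    apply/ipath_consP; split=> // u us; rewrite xA ?mem_cat ?us //.
    by case: s us {IH ips H xs xA}.
  move=> a y; rewrite inE => /predU1P[->|sa] yt; last first.
    have [-> ->] := H _ _ sa yt; split=> //; congr (_ && _).
    by case: s sa {IH ips H xs xA}.
  split; first by apply: contraNneq xt => ->.
  rewrite xA ?mem_cat ?yt ?orbT //.
  case: s xs xA H {IH ips} => [|b s] /= xs xA H; first by rewrite eqxx.
  rewrite (negbTE (_ : x != _)); last first.
    by apply: contraNneq xs => ->; rewrite mem_last.
  apply: negbTE; rewrite eq_sym.
  by case: (H b y (mem_head _ _) yt).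
- move=> /ipath_consP[ips xs xA] ipt H; apply/ipath_consP; split.
  + apply: IH => // a y sa yt; have [] := H a y _ yt; first by rewrite inE sa orbT.
    by move=> -> ->; split=> //; case: s sa {ips xs xA H}.
  + rewrite mem_cat negb_or xs /=; apply/negP => xt.
    by have [] := H x x (mem_head _ _) xt; rewrite eqxx.
  + move=> u; rewrite mem_cat => /orP[us|ut].
      by rewrite xA //; case: s us {IH ips H xs xA}.
    have [_ ->] := H x u (mem_head _ _) ut.
    case: s xs xA H {IH ips} => [|b s] /= xs xA H; first by rewrite eqxx.
    rewrite (negbTE (_ : x != _)); last first.
      by apply: contraNneq xs => ->; rewrite mem_last.
    apply/esym/negbTE; rewrite eq_sym.
    by case: (H b u _ ut); rewrite ?inE ?eqxx ?orbT.
Qed.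

Lemma ipath_rev s : ipath (rev s) = ipath s.
Proof.
suff H t : ipath t -> ipath (rev t) by apply/idP/idP => /H //; rewrite revK.
elim: t => // x t IH /ipath_consP[/IH ipt xt xA]; rewrite rev_cons -cats1.
apply/ipath_catP; split=> // a y; rewrite mem_rev inE => at' /eqP->.
rewrite /= eqxx andbT adj_sym xA //; split; first by apply: contraNneq xt => <-.
by case: t at' {IH ipt xt xA} => // b t _; rewrite rev_cons last_rcons.
Qed.

Lemma ipath_uniq s : ipath s -> uniq s.
Proof. by elim: s => //= x s IH /and3P[/IH-> ->]. Qed.

Lemma ipath_path x s : ipath (x :: s) -> path adj x s.
Proof.
elim: s x => //= y s IH x /and3P[/IH ps _ /andP[+ _]].
by rewrite !eqxx => /eqP->.
Qed.

Lemma ipath_index s : ipath s ->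
  {in s &, forall u v, adj u v ->
     index v s = (index u s).+1 \/ index u s = (index v s).+1}.
Proof.
elim: s => // x s IH /ipath_consP[/IH {}IH xs xA] u v.
have H y : y \in s -> adj x y -> index y (x :: s) = 1.
  move=> ys; rewrite xA // => /eqP yE /=.
  rewrite (negbTE (_ : x != y)); last by apply: contraNneq xs => ->.
  by case: s yE {ys IH xs xA} => // b s /= ->; rewrite eqxx.
rewrite !inE => /predU1P[->|us] /predU1P[->|vs].
- by rewrite adj_irrefl.
- by move=> xv; left; rewrite (H v) //= eqxx.
- by rewrite adj_sym => xu; right; rewrite (H u) //= eqxx.
move=> uv /=; rewrite (negbTE (_ : x != v)); last by apply: contraNneq xs => ->.
rewrite (negbTE (_ : x != u)); last by apply: contraNneq xs => ->.
by have [->|->] := IH _ _ us vs uv; [left|right].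
Qed.

Lemma ipath_chordless x s : ipath (x :: s) -> chordless_path x s (last x s).
Proof.
move=> ips; split=> //; [exact: ipath_path | exact: ipath_uniq |].
by move=> u v us vs uv; apply: ipath_index.
Qed.

(** Induction on the walk: let [y :: t] be the induced path for its tail. If [x] already lies on it,
    everything before [x] is dropped; otherwise [x] is joined to its last neighbour on it, after
    which there is no further neighbour of [x]. *)
Lemma walk_ipath x s : path adj x s ->
  exists t, [/\ ipath (x :: t), last x t = last x s & {subset t <= s}].
Proof.
elim: s x => [|y s IH] x /=; first by exists [::].
case/andP=> xy /IH[t [ipt <- ts]].
have ts' : {subset y :: t <= y :: s}.
  by move=> u; rewrite !inE => /predU1P[->|/ts->]; rewrite ?eqxx ?orbT.
have [xt|xt] := boolP (x \in y :: t).
  have [p1 [p2 E]] : exists p1 p2, y :: t = p1 ++ x :: p2.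
    by case/splitPr: xt => p1 p2; exists p1, p2.
  exists p2; split.
  - by move: ipt; rewrite E => /ipath_catP[].
  - by rewrite -[RHS]/(last x (y :: t)) E last_cat.
  - by move=> u up; apply: ts'; rewrite E mem_cat inE up !orbT.
have : has (adj x) (y :: t) by rewrite /= xy.
case/split_last=> p1 [u [p2 [E xu xp2]]].
move: ipt; rewrite E => /ipath_catP[_ ip2 _].
exists (u :: p2); split.
- apply/ipath_consP; split=> //.
    by apply: contra xt; rewrite E mem_cat orbC => ->.
  move=> w; rewrite inE => /predU1P[->|wp]; first by rewrite xu eqxx.
  rewrite (negbTE (hasPn xp2 _ wp)); apply/esym/negbTE.
  by apply: contraTneq wp => /= ->; case/ipath_consP: ip2.
- by rewrite -[RHS]/(last x (y :: t)) E last_cat.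
- by move=> w wp; apply: ts'; rewrite E mem_cat wp orbT.
Qed.

End InducedPaths.

(** * Moving induced paths between a graph and its induced subgraphs *)

Section Transfer.
Variables (G : sgraph) (A : {set G}).
Implicit Types (s t : seq (induced A)).

Lemma ipath_val s : ipath (map val s) = ipath s.
Proof.
elim: s => //= x s ->; rewrite (mem_map val_inj) all_map; congr [&& _, _ & _].
by apply: eq_in_all => u; case: s => //= y s _; rewrite -val_eqE.
Qed.

Definition lift_seq (s : seq G) : seq (induced A) := pmap insub s.

Lemma val_lift_seq (s : seq G) : {subset s <= A} -> map val (lift_seq s) = s.
Proof.
move=> sA; rewrite /lift_seq (pmap_filter (@insubK _ _ _)) -[RHS](filter_predT s).
by apply: eq_in_filter => x /sA xA /=; rewrite insubT.
Qed.

End Transfer.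

Arguments ipath : simpl never.

Lemma isomorphic_refl (H : sgraph) : isomorphic H H.
Proof. by exists id => //; exists id. Qed.

(** * Thetas and pyramids from three induced paths *)

Section Configurations.
Variable G : sgraph.
Implicit Types (a b c x y z u v w : G) (s t p q r : seq G).

Definition anticomplete s t := {in s & t, forall x y, x != y /\ adj x y = false}.

Lemma anticompleteC s t : anticomplete s t -> anticomplete t s.
Proof. by move=> H x y xt ys; have [] := H y x ys xt; rewrite eq_sym adj_sym. Qed.

Lemma anticomplete_sub s t s' t' : anticomplete s t ->
  {subset s' <= s} -> {subset t' <= t} -> anticomplete s' t'.
Proof. by move=> H ss tt x y /ss xs /tt; apply: H. Qed.

Lemma three_pairwise (P : 'I_3 -> 'I_3 -> Prop) :
  (forall i j, P i j -> P j i) ->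
  P (inord 0) (inord 1) -> P (inord 0) (inord 2) -> P (inord 1) (inord 2) ->
  forall i j, i != j -> P i j.
Proof.
move=> sP P01 P02 P12 i j.
have E k : k = inord 0 \/ k = inord 1 \/ k = inord 2 :> 'I_3.
  by case: k => [[|[|[|//]]] ki]; [left | right; left | right; right];
    apply: val_inj; rewrite /= inordK.
by have [-> | [-> | ->]] := E i; have [-> | [-> | ->]] := E j;
  rewrite ?eqxx // => _; auto.
Qed.

Lemma three_all (P : 'I_3 -> Prop) :
  P (inord 0) -> P (inord 1) -> P (inord 2) -> forall i, P i.
Proof.
move=> P0 P1 P2 [[|[|[|//]]] ki];
  [move: P0 | move: P1 | move: P2]; congr P; apply: val_inj; exact: inordK.
Qed.

Definition three T (x0 x1 x2 : T) (i : 'I_3) : T := nth x0 [:: x0; x1; x2] i.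

Lemma threeE T (x0 x1 x2 : T) :
  ((three x0 x1 x2 (inord 0) = x0) * (three x0 x1 x2 (inord 1) = x1) *
   (three x0 x1 x2 (inord 2) = x2))%type.
Proof. by rewrite /three !inordK. Qed.

(** The union of the three paths induces a theta. With the ends stripped off, nonempty interiors
    mean lengths at least 2, and all edges at [a] or [b] are governed by the three induced paths, so
    only the interiors remain to be compared. *)
Lemma theta_free_paths : free_of is_theta G -> forall a b p q r,
  ipath (a :: rcons p b) -> ipath (a :: rcons q b) -> ipath (a :: rcons r b) ->
  0 < size p -> 0 < size q -> 0 < size r ->
  anticomplete p q -> anticomplete p r -> anticomplete q r -> False.
Proof.
move=> tf a b p q r ip iq ir p0 q0 r0 pq pr qr.
pose A := [set x | x \in a :: b :: p ++ q ++ r].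
pose P := three p q r; have PE := threeE p q r; rewrite -/P in PE.
have PA i : {subset a :: rcons (P i) b <= A}.
  move: i; apply: three_all => x; rewrite PE in_set !inE mem_rcons !inE !mem_cat;
  by do 2!case/orP=> [-> //|]; rewrite ?orbT // => ->; rewrite ?orbT.
have Pi i : ipath (a :: rcons (P i) b) by move: i; apply: three_all; rewrite PE.
have Ps i : 0 < size (P i) by move: i; apply: three_all; rewrite PE.
have PP : forall i j, i != j -> anticomplete (P i) (P j).
  by apply: three_pairwise => [i j /anticompleteC|||]; rewrite ?PE.
have aA : a \in A by apply: (PA (inord 0)); rewrite mem_head.
have bA : b \in A by rewrite in_set !inE eqxx orbT.
have lE i : map val (lift_seq A (rcons (P i) b)) = rcons (P i) b.
  by apply: val_lift_seq => x xP; apply: (PA i); rewrite inE xP orbT.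
pose a' : induced A := exist _ a aA; pose b' : induced A := exist _ b bA.
have inP i (x : induced A) : x \in a' :: lift_seq A (rcons (P i) b) ->
    [\/ x = a', x = b' | val x \in P i].
  move=> xP; have := map_f val xP; rewrite /= lE inE mem_rcons inE.
  by case/or3P=> [/eqP xa|/eqP xb|]; [constructor 1|constructor 2|constructor 3] => //;
    apply: val_inj.
apply: (tf (induced A)); last by exists A; apply: isomorphic_refl.
exists a', b', (fun i => lift_seq A (rcons (P i) b)); split.
- move=> i; have -> : b' = last a' (lift_seq A (rcons (P i) b)).
    by apply: val_inj; rewrite -last_map lE last_rcons.
  by apply: ipath_chordless; rewrite -ipath_val map_cons lE; apply: Pi.
- by move=> i; rewrite -(size_map val) lE size_rcons ltnS.
- move=> i j /PP ij x /inP[||xi]; [by left | by right |].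
  case/inP=> [||xj]; [by left | by right |].
  by have [] := ij _ _ xi xj; rewrite eqxx.
- move=> i j /PP ij x y /inP[-> | -> |xi] /inP[-> | -> |yj] xy;
    try by [constructor 1 | constructor 2 | constructor 3 | constructor 4].
  by have [_] := ij _ _ xi yj; rewrite [adj _ _]xy.
- move=> x; have := valP x; rewrite in_set !inE !mem_cat.
  have H i : val x \in a :: rcons (P i) b ->
      exists i, x \in a' :: lift_seq A (rcons (P i) b).
    by move=> xi; exists i; rewrite -(mem_map val_inj) /= lE.
  case/orP=> [xa|/orP[xb|/or3P[xp|xp|xp]]].
  + by apply: (H (inord 0)); rewrite inE xa.
  + by apply: (H (inord 0)); rewrite inE mem_rcons inE xb orbT.
  + by apply: (H (inord 0)); rewrite inE mem_rcons inE PE xp !orbT.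
  + by apply: (H (inord 1)); rewrite inE mem_rcons inE PE xp !orbT.
  + by apply: (H (inord 2)); rewrite inE mem_rcons inE PE xp !orbT.
Qed.

(** The union of the three paths induces a pyramid with apex [a]. The apex is stripped off, and
    [far] tolerates between two paths only the edge joining their final vertices. The two size
    hypotheses say that the first path and one of the others have length at least 2. *)
Lemma pyramid_free_paths : free_of is_pyramid G -> forall a x y z p q r,
  ipath (a :: rcons p x) -> ipath (a :: rcons q y) -> ipath (a :: rcons r z) ->
  triangle x y z -> 0 < size p -> 0 < size q + size r ->
  let far s t x y := {in s & t, forall u v,
        u != v /\ (adj u v -> u = x /\ v = y)} in
  far (rcons p x) (rcons q y) x y -> far (rcons p x) (rcons r z) x z ->
  far (rcons q y) (rcons r z) y z -> False.
Proof.
move=> pf a x y z p q r ip iq ir xyz p0 qr0 far pq pr qr.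
pose A := [set u | u \in a :: rcons p x ++ rcons q y ++ rcons r z].
pose P := three p q r; have PE := threeE p q r; rewrite -/P in PE.
pose B := three x y z; have BE := threeE x y z; rewrite -/B in BE.
have PA i : {subset a :: rcons (P i) (B i) <= A}.
  move: i; apply: three_all => u; rewrite ?PE ?BE in_set !inE !mem_cat;
  by case/orP=> [-> //|->]; rewrite ?orbT.
have Pi i : ipath (a :: rcons (P i) (B i)).
  by move: i; apply: three_all; rewrite ?PE ?BE.
have PP : forall i j, i != j -> far (rcons (P i) (B i)) (rcons (P j) (B j)) (B i) (B j).
  apply: three_pairwise => [i j H u v ui vj||| ]; rewrite ?PE ?BE //.
  by have [ne uv] := H v u vj ui; rewrite eq_sym adj_sym; split=> // /uv[].
have aA : a \in A by apply: (PA (inord 0)); rewrite mem_head.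
have BA i : B i \in A by apply: (PA i); rewrite inE mem_rcons mem_head orbT.
have lE i : map val (lift_seq A (rcons (P i) (B i))) = rcons (P i) (B i).
  by apply: val_lift_seq => u uP; apply: (PA i); rewrite inE uP orbT.
pose a' : induced A := exist _ a aA.
pose B' i : induced A := exist _ (B i) (BA i).
have inP i (u : induced A) : u \in a' :: lift_seq A (rcons (P i) (B i)) ->
    u = a' \/ val u \in rcons (P i) (B i).
  move=> uP; have := map_f val uP; rewrite /= lE inE.
  by case/orP=> [/eqP ua|]; [left; apply: val_inj | right].
apply: (pf (induced A)); last by exists A; apply: isomorphic_refl.
exists a', B', (fun i => lift_seq A (rcons (P i) (B i))); split.
- split=> [i|]; last by rewrite /triangle /= /induced_adj /= ?PE ?BE.
  have -> : B' i = last a' (lift_seq A (rcons (P i) (B i))).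
    by apply: val_inj; rewrite -last_map lE last_rcons.
  by apply: ipath_chordless; rewrite -ipath_val map_cons lE; apply: Pi.
- split=> [i|]; first by rewrite -(size_map val) lE size_rcons.
  have sE i : (1 < size (lift_seq A (rcons (P i) (B i)))) = (0 < size (P i)).
    by rewrite -(size_map val) lE size_rcons.
  rewrite addn_gt0 in qr0.
  (* [k] is a second path of length at least 2 beside path 0, so these two indices witness the
     cardinality bound. *)
  have [k [k0 Pk]] : exists k, inord 0 != k /\ 0 < size (P k).
    case/orP: qr0 => [q0|r0]; [exists (inord 1) | exists (inord 2)];
    by rewrite PE -val_eqE /= !inordK.
  apply: (@leq_trans #|[set inord 0; k]|); first by rewrite cards2 k0.
  apply/subset_leq_card/subsetP=> i.
  by rewrite !inE sE => /orP[] /eqP->; rewrite ?PE.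
- move=> i j /PP ij u /inP[//|ui] /inP[//|uj].
  by have [] := ij _ _ ui uj; rewrite eqxx.
- move=> i j /PP ij u v /inP[-> _ _|ui]; first by constructor 1.
  case/inP=> [-> _|vj]; first by constructor 2.
  move=> uv; have [_ H] := ij _ _ ui vj.
  by have [uE vE] := H uv; constructor 3; split; apply: val_inj.
- move=> u; have := valP u; rewrite in_set inE !mem_cat.
  have H i : val u \in a :: rcons (P i) (B i) ->
      exists i, u \in a' :: lift_seq A (rcons (P i) (B i)).
    by move=> ui; exists i; rewrite -(mem_map val_inj) /= lE.
  case/orP=> [ua|/or3P[up|up|up]].
  + by apply: (H (inord 0)); rewrite inE ua.
  + by apply: (H (inord 0)); rewrite inE ?PE ?BE up orbT.
  + by apply: (H (inord 1)); rewrite inE ?PE ?BE up orbT.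
  + by apply: (H (inord 2)); rewrite inE ?PE ?BE up orbT.
Qed.

End Configurations.

(** * Holes as an induced path closed up by one vertex *)

Section Holes.
Variable G : sgraph.
Implicit Types (a b c r x y z u v w : G) (s t p q : seq G).

(** A hole cut open at [z]: the rest is an induced path on at least three vertices in which [z] sees
    exactly the two ends. This makes holes accessible to the concatenation lemmas for [ipath]. *)
Definition closing z s : Prop :=
  [/\ ipath s, 2 < size s, z \notin s
    & {in s, forall u, adj z u = (u == head u s) || (u == last u s)}].

Lemma closing_hole z s : closing z s -> is_hole (z :: s).
Proof.
case=> ips s3 zs zA; case: s s3 ips zs zA => // x p p2 ips zs zA.
have xs : x \in x :: p by rewrite mem_head.
have ls : last x p \in x :: p by rewrite mem_last.
have up := ipath_uniq ips.
split; [split | exact: p2 | ].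
- exact: ltnW.
- by rewrite cons_uniq zs up.
- rewrite /= rcons_path ipath_path // [adj (last x p) z]adj_sym !zA //= !eqxx ?orbT //.
case=> u [v]; move: u v.
have nz : next (z :: x :: p) z = x by rewrite next_nth mem_head /= eqxx.
(* The default [z] of [nth] is what closes the cycle: the index after the last vertex of the path is
   out of range, and [z] is returned. *)
have ns u : u \in x :: p ->
    next (z :: x :: p) u = nth z (x :: p) (index u (x :: p)).+1.
  move=> us; rewrite next_nth inE us orbT; congr nth.
  rewrite [LHS]/= (negbTE (_ : z != u)) //.
  by apply: contraNneq zs => ->.
have nl : next (z :: x :: p) (last x p) = z.
  by rewrite ns // index_last // nth_default.
have nzv v : v \in z :: x :: p -> adj z v -> v != next (z :: x :: p) z ->
    z != next (z :: x :: p) v -> False.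
  rewrite nz inE => /predU1P[->|vs]; first by rewrite adj_irrefl.
  rewrite zA // => /orP[] /eqP E; first by rewrite [v]E eqxx.
  by move=> _; rewrite [v]E nl eqxx.
move=> u v [us vs uv nu nv].
move: us; rewrite inE => /predU1P[uz|us].
  by move: uv nu nv; rewrite uz => uv nu nv; apply: nzv nu nv.
move: vs; rewrite inE => /predU1P[vz|vs].
  move: uv nu nv; rewrite vz adj_sym => uv nu nv; apply: nzv nv nu => //.
  by rewrite inE us orbT.
have [E|E] := ipath_index ips us vs uv.
  by move: nu; rewrite ns // -E nth_index // eqxx.
by move: nv; rewrite ns // -E nth_index // eqxx.
Qed.

End Holes.

(** * Attachments of a vertex to a hole *)

Section ThetaWheelFree.
Variable G : sgraph.
Implicit Types (a b c r x y z u v w : G) (s t p q : seq G).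

Lemma is_hole_val (A : {set G}) (h : seq (induced A)) :
  is_hole (map val h) -> is_hole h.
Proof.
rewrite /is_hole /is_cycle size_map (map_inj_uniq val_inj) cycle_map.
case=> [[h2 uh ch] h3 nc]; split=> // -[x [y [xh yh xy nx ny]]]; apply: nc.
exists (val x), (val y); rewrite !(next_map val_inj) // !(mem_map val_inj).
by rewrite !(inj_eq val_inj).
Qed.

(** The neighbours of the centre are passed as a duplicate-free list [t], so that exhibiting three
    of them replaces a cardinality computation in the induced subgraph. *)
Lemma wheel_free_hole : free_of is_wheel G -> forall w h t,
  is_hole h -> w \notin h ->
  uniq t -> {subset t <= h} -> all (adj w) t -> 2 < size t -> False.
Proof.
move=> wf w h t hole_h wh ut th wt t3.
pose A := [set x | x \in w :: h].
have hA : {subset h <= A} by move=> x xh; rewrite in_set inE xh orbT.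
have wA : w \in A by rewrite in_set mem_head.
pose w' : induced A := exist _ w wA.
have hE : map val (lift_seq A h) = h by apply: val_lift_seq.
apply: (wf (induced A)); last by exists A; apply: isomorphic_refl.
exists w', (lift_seq A h); split.
- by apply: is_hole_val; rewrite hE.
- by rewrite -(mem_map val_inj) hE.
- apply: leq_trans t3 _; have tA : {subset t <= A} by move=> x /th/hA.
  rewrite -(val_lift_seq tA) size_map -(card_uniqP _).
    apply/subset_leq_card/subsetP=> u; rewrite -(mem_map val_inj) val_lift_seq //.
    by move=> ut'; rewrite in_set -(mem_map val_inj) hE th //; apply: (allP wt).
  by rewrite -(map_inj_uniq val_inj) val_lift_seq.
- move=> x; have := valP x; rewrite in_set inE.
  case/orP=> [/eqP xw|xh]; [left; exact: val_inj | right].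
  by rewrite -(mem_map val_inj) hE.
Qed.

Lemma wheel_free_closing : free_of is_wheel G -> forall w z s t,
  closing z s -> w \notin z :: s ->
  uniq t -> {subset t <= z :: s} -> all (adj w) t -> 2 < size t -> False.
Proof. by move=> wf w z s t /closing_hole; apply: wheel_free_hole. Qed.

Lemma ipath_anticomplete p r q : ipath (p ++ r :: q) -> anticomplete p q.
Proof.
case/ipath_catP=> _ /ipath_consP[_ rq _] H x y xp yq.
have [|ne ->] := H x y xp; first by rewrite inE yq orbT.
by split=> //=; rewrite andbC (negbTE (_ : y != r)) //; apply: contraNneq rq => <-.
Qed.

Lemma ipath_prefix p r q : ipath (p ++ r :: q) -> ipath (rcons p r).
Proof. by rewrite -cat_rcons => /ipath_catP[]. Qed.

Lemma closing_rev z s : closing z s -> closing z (rev s).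
Proof.
case=> ips s3 zs zA; split; rewrite ?ipath_rev ?size_rev ?mem_rev //.
move=> u; rewrite mem_rev => us; rewrite zA // orbC.
have -> : head u (rev s) = last u s.
  by case: (lastP s) => // t x; rewrite rev_rcons last_rcons.
by case: (s) => // x t; rewrite rev_cons last_rcons.
Qed.

(** As [q] is nonempty, the second neighbour of [z] lies in [q]; within [p] only the first vertex is
    adjacent to [z]. *)
Lemma closing_prefix z p q :
  closing z (p ++ q) -> 0 < size p -> 0 < size q -> ipath (z :: p).
Proof.
case=> /ipath_catP[ipp ipq pq] _ zs zA p0 q0.
apply/ipath_consP; split=> // [|u up].
  by apply: contra zs; rewrite mem_cat => ->.
case: q q0 {ipq zs} pq zA => // y q _ pq zA.
rewrite zA ?mem_cat ?up // last_cat (_ : u == last _ _ = false).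
  by rewrite orbF; case: p up {p0 ipp pq zA}.
by apply/negbTE; case: (pq u (last y q) up (mem_last _ _)).
Qed.

Lemma ipath3 x y z :
  ipath [:: x; y; z] = [&& adj x y, adj y z, x != z & ~~ adj x z].
Proof.
rewrite /ipath /= !inE negb_or !eqxx !andbT !eqb_id.
case xy: (adj x y); case yz: (adj y z); rewrite ?andbF //=.
have -> : y != z by apply: contraTneq yz => ->; rewrite adj_irrefl.
have -> : x != y by apply: contraTneq xy => ->; rewrite adj_irrefl.
have /negbTE-> : z != y by apply: contraTneq yz => ->; rewrite adj_irrefl.
by rewrite /= eqbF_neg.
Qed.

(* If [w] had no third neighbour in the hole, its two neighbours would be the
   ends of a theta. *)
Lemma closing_interior_adj :
  free_of is_theta G -> free_of is_wheel G -> forall w z p r q,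
  closing z (p ++ r :: q) -> 0 < size p -> 0 < size q ->
  w \notin z :: p ++ r :: q -> adj w z -> adj w r -> False.
Proof.
move=> tf wf w z p r q cl p0 q0 ws wz wr.
have [ips s3 zs zA] := cl.
have zr : z != r by apply: contraNneq zs => ->; rewrite mem_cat mem_head orbT.
have [/hasP[u up wu]|/hasPn wpq] := boolP (has (adj w) (p ++ q)).
  have upr : u \in p ++ r :: q.
    by move: up; rewrite !mem_cat inE => /orP[->//|->]; rewrite !orbT.
  apply: (wheel_free_closing wf (t := [:: z; r; u]) cl ws) => //.
  - rewrite /= !inE negb_or zr andbT /=.
    have -> : z != u by apply: contraNneq zs => ->.
    apply: contraTneq up => <-.
    have := ipath_uniq ips; rewrite -cat_rcons cat_uniq rcons_uniq mem_cat negb_or.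
    case/and3P=> /andP[-> _] /hasPn H _ /=.
    by apply/negP=> /H; rewrite /= mem_rcons mem_head.
  - move=> x; rewrite !inE => /or3P[] /eqP->; rewrite ?eqxx // ?upr ?orbT //.
    by rewrite mem_cat mem_head !orbT.
  - by rewrite /= wz wr wu.
have wp : anticomplete [:: w] (p ++ q).
  move=> x y /[!inE] /eqP-> ypq; split; last exact/negbTE/wpq.
  apply: contraNneq ws => ->; move: ypq; rewrite inE !mem_cat inE.
  by case/orP=> ->; rewrite !orbT.
have ipq := ipath_anticomplete ips.
have ipzp : ipath (z :: rcons p r).
  by apply: (closing_prefix (q := q)); rewrite ?cat_rcons ?size_rcons.
have ipzq : ipath (z :: rcons (rev q) r).
  apply: (closing_prefix (q := rev p)); rewrite ?cat_rcons ?size_rcons ?size_rev //.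
  by have := closing_rev cl; rewrite rev_cat rev_cons cat_rcons.
apply: (theta_free_paths tf (a := z) (b := r) (p := [:: w]) (q := p) (r := rev q)).
- rewrite ipath3 adj_sym wz wr zr /=.
  have [_ _ ->] := ipath_consP _ _ ipzp; last by rewrite mem_rcons mem_head.
  case: (p) p0 ips => // x p' _ /ipath_uniq /andP[xn _].
  by apply: contraNneq xn => /= <-; rewrite mem_cat mem_head orbT.
- by [].
- by [].
- by [].
- by [].
- by rewrite size_rev.
- by apply: anticomplete_sub wp _ _ => // x xp; rewrite mem_cat xp.
- by apply: anticomplete_sub wp _ _ => // x; rewrite mem_rev mem_cat => ->; rewrite orbT.
- by apply: anticomplete_sub ipq _ _ => // x; rewrite mem_rev.
Qed.

End ThetaWheelFree.

(** * Clique cutsets and diamonds *)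

Section NoCliqueCutset.
Variable G : sgraph.
Implicit Types (a b c k r x y z u v w : G) (s t p q : seq G) (K S : {set G}).

Definition cliqueb S := [forall x in S, forall y in S, (x != y) ==> adj x y].

Lemma cliqueP S : reflect (clique S) (cliqueb S).
Proof.
apply: (iffP forall_inP) => [H x y xS yS|H x xS].
  by move/forall_inP: (H x xS) => /(_ y yS)/implyP.
by apply/forall_inP=> y yS; apply/implyP/H.
Qed.

(** The absence of a clique cutset, phrased with induced paths of [G] itself so that later arguments
    need not enter [G] minus [S]. *)
Definition clique_connected : Prop := forall S x y,
  clique S -> x \notin S -> y \notin S ->
  exists p, [/\ ipath (x :: p), last x p = y & {in p, forall u, u \notin S}].

Definition diamond_free : Prop := forall u v x y, adj u v ->
  adj x u -> adj x v -> adj y u -> adj y v -> x != y -> adj x y.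

Definition complete_to K x := [forall k in K, adj x k].

Lemma complete_notin K x : complete_to K x -> x \notin K.
Proof. by move/forall_inP=> xK; apply/negP=> /xK; rewrite adj_irrefl. Qed.

(* A shortest path outside a maximal clique between two nonadjacent vertices
   complete to it yields a wheel centred in the clique. *)
Lemma wheel_free_diamond_free :
  free_of is_wheel G -> clique_connected -> diamond_free.
Proof.
move=> wf cc u v x y uv xu xv yu yv xy; apply: contraT => nxy.
pose Q K := [&& 1 < #|K|, cliqueb K & [exists x, exists y,
  [&& x != y, ~~ adj x y, complete_to K x & complete_to K y]]].
have Quv : Q [set u; v].
  have nuv : u != v by apply: contraTneq uv => ->; rewrite adj_irrefl.
  apply/and3P; split; first by rewrite cards2 nuv.
    apply/cliqueP=> a b /set2P[]-> /set2P[]-> //; rewrite ?eqxx //.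
    by rewrite adj_sym.
  apply/existsP; exists x; apply/existsP; exists y; rewrite xy nxy /=.
  by apply/andP; split; apply/forall_inP=> a /set2P[] ->.
(* [K] is largest among the cliques of size at least 2 having two nonadjacent vertices complete to
   them, not among all cliques. *)
case: (arg_maxnP (fun K : {set G} => #|K|) Quv) => K QK Kmax.
case/and3P: QK => K1 /cliqueP Kc /existsP[x0 /existsP[y0 /and4P[xy0 nxy0 xK0 yK0]]].
have [p0 [ip0 lp0 p0K]] := cc K x0 y0 Kc (complete_notin xK0) (complete_notin yK0).
(* Induction on length replaces the choice of a shortest path. An inner vertex complete to [K]
   either is nonadjacent to one end, which gives a shorter path, or is adjacent to both and can be
   added to [K]. *)
suff main n x1 p : size p < n -> ipath (x1 :: p) -> x1 != last x1 p ->
    ~~ adj x1 (last x1 p) -> complete_to K x1 -> complete_to K (last x1 p) ->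
    {in p, forall u, u \notin K} -> False.
  by case: (main (size p0).+1 x0 p0); rewrite ?lp0.
elim: n x1 p => // n IH x1; case/lastP=> [|p y1]; first by rewrite eqxx.
rewrite last_rcons size_rcons ltnS => sp ip xy1 nxy1 xK yK pK.
have [/hasP[z zp zK]|npK] := boolP (has (complete_to K) p).
  have [p1 [p2 E]] : exists p1 p2, p = p1 ++ z :: p2.
    by case/splitPr: zp => p1 p2; exists p1, p2.
  have zi : z \in rcons p y1 by rewrite mem_rcons inE zp orbT.
  have x1z : x1 != z.
    by apply: contraTneq zi => <-; case/ipath_consP: ip.
  have zy1 : z != y1.
    apply: contraTneq zp => ->; case/ipath_consP: ip => /ipath_uniq.
    by rewrite rcons_uniq => /andP[].
  have spE := sp; rewrite E size_cat /= in spE.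
  have [xz|nxz] := boolP (adj x1 z); last first.
    apply: (IH x1 (rcons p1 z)); rewrite ?last_rcons ?size_rcons //.
    - by apply: leq_ltn_trans spE; rewrite addnS ltnS leq_addr.
    - by apply: (@ipath_prefix _ (x1 :: p1) z (rcons p2 y1)); move: ip; rewrite E rcons_cat.
    - move=> a; rewrite mem_rcons inE => /predU1P[->|ap]; first exact: pK.
      by apply: pK; rewrite mem_rcons inE E mem_cat ap !orbT.
  have [zy|nzy] := boolP (adj z y1); last first.
    apply: (IH z (rcons p2 y1)); rewrite ?last_rcons ?size_rcons //.
    - by apply: leq_ltn_trans spE; rewrite leq_addl.
    - by move: ip; rewrite E rcons_cat -cat_cons => /ipath_catP[].
    - move=> a; rewrite mem_rcons => ap; apply: pK.
      by rewrite mem_rcons inE E mem_cat inE; 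
      by move: ap; rewrite inE => /orP[]->; rewrite ?orbT.
  have zK' := complete_notin zK.
  suff /Kmax : Q (z |: K) by rewrite /= cardsU1 zK' add1n ltnn.
  apply/and3P; split; first by rewrite cardsU1 zK' add1n ltnW.
    apply/cliqueP=> a b /setU1P[->|aK] /setU1P[->|bK] ab.
    - by rewrite eqxx in ab.
    - exact: (forall_inP zK).
    - by rewrite adj_sym; apply: (forall_inP zK).
    - exact: Kc.
  apply/existsP; exists x1; apply/existsP; exists y1; rewrite xy1 nxy1 /=.
  apply/andP; split; apply/forall_inP=> a /setU1P[->//|aK].
  - exact: (forall_inP xK).
  - by rewrite adj_sym.
  - exact: (forall_inP yK).
have Kne (a : G) : exists2 k, k \in K & k != a.
  have : 0 < #|K :\ a|.
    by move: K1; rewrite (cardsD1 a); case: (_ \in _) => //; apply: ltnW.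
  by case/card_gt0P=> k /setD1P[ka kK]; exists k.
have yadj k : k \in K -> adj k y1 by move=> kK; rewrite adj_sym; apply: (forall_inP yK).
have : has (fun u => [exists k in K, adj k u]) (rcons p y1).
  apply/hasP; exists y1; first by rewrite mem_rcons mem_head.
  by have [k kK _] := Kne y1; apply/exists_inP; exists k; rewrite ?yadj.
(* [x'] is the first vertex after [x1] with a neighbour [k] in [K]; this [k] becomes the centre of
   the wheel. *)
case/split_first=> p1 [x' [p2 [E /exists_inP[k kK kx'] np1]]].
have lE : last x' p2 = y1 by rewrite -(last_rcons x1 p y1) E last_cat.
(* [k'] will close the hole. No inner vertex is complete to [K], so [k'] can miss [x'] unless [x']
   is the end [y1]. *)
have [k' k'K [kk' nk'x]] :
    exists2 k', k' \in K & k' != k /\ (adj k' x' -> x' = y1).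
  have [->|x'y1] := eqVneq x' y1; first by have [k' ? ?] := Kne k; exists k'.
  have : x' \in rcons p y1 by rewrite E mem_cat mem_head orbT.
  rewrite mem_rcons inE (negbTE x'y1) /= => /(hasPn npK).
  case/forall_inPn=> k' k'K nk'; exists k' => //; split.
    by apply: contraNneq nk' => ->; rewrite adj_sym.
  by rewrite adj_sym (negbTE nk').
have : has (adj k') (x' :: p2).
  by apply/hasP; exists y1; rewrite ?yadj // -lE mem_last.
case/split_first=> q1 [x'' [q2 [E2 k'x'' nq1]]].
have ips : ipath (rcons (x1 :: p1 ++ q1) x'').
  by apply: (@ipath_prefix _ _ _ q2); move: ip; rewrite E E2 /= catA.
pose s := rcons (x1 :: p1 ++ q1) x''.
have memS a : (a \in s) = [|| a == x1, a \in p1, a \in q1 | a == x''].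
  rewrite /s mem_rcons in_cons [a \in x1 :: _]in_cons mem_cat.
  by case: (a == x''); rewrite ?orbT ?orbF.
have sK a : a \in s -> a \notin K.
  rewrite memS => aH.
  have [-> |ax] := eqVneq a x1; first exact: complete_notin.
  apply: pK; rewrite E E2 !mem_cat inE; move: aH; rewrite (negbTE ax) /=.
  by case/or3P=> ->; rewrite ?orbT.
have x's : x' \in rcons q1 x''.
  case: (q1) E2 => [|d q1'] /= [-> _]; first by rewrite inE.
  by rewrite inE eqxx.
have x'ne : x' \in s by rewrite /s rcons_cons rcons_cat inE mem_cat x's !orbT.
have x1x' : x1 != x'.
  apply: contraTneq (x's) => <-; move: ips; rewrite rcons_cons rcons_cat.
  by case/ipath_consP=> _; rewrite mem_cat negb_or => /andP[].
have cl : closing k' s.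
  split=> //.
  (* If [p1] and [q1] are empty then [x''] is [x'], so [k'] is adjacent to [x']; hence [x'] is [y1],
     which would be adjacent to [x1]. *)
  - rewrite /s size_rcons /= !ltnS lt0n; apply/eqP => /size0nil pq0.
    move: E2 E nxy1; case: p1 pq0 {np1 ips s memS sK x'ne} => //= -> /=.
    move=> [x''E _] E; case/negP.
    have <- : x' = y1 by apply: nk'x; rewrite x''E.
    by move/ipath_path: ip; rewrite E /= => /andP[].
  - by apply/negP => /sK; rewrite k'K.
  - move=> a aS; rewrite /s last_rcons rcons_cons /=.
    have := ipath_uniq ips; rewrite rcons_uniq /= => /and3P[x''n x1n _].
    have nax1 : a \in p1 ++ q1 -> a != x1 by apply: contraTneq => ->.
    have nax'' : a \in p1 ++ q1 -> a != x''.
      by move=> aH; apply: contraNneq x''n => <-; rewrite inE aH orbT.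
    move: aS; rewrite memS => /or4P[/eqP->|ap|aq|/eqP->].
    + by rewrite eqxx adj_sym (forall_inP xK).
    + rewrite (negbTE (nax1 _)) ?(negbTE (nax'' _)) ?mem_cat ?ap //.
      by apply/negbTE; apply: contra (hasPn np1 _ ap) => ka; apply/exists_inP; exists k'.
    + rewrite (negbTE (nax1 _)) ?(negbTE (nax'' _)) ?mem_cat ?aq ?orbT //.
      exact/negbTE/(hasPn nq1).
    + by rewrite k'x'' eqxx orbT.
apply: (wheel_free_closing wf (t := [:: k'; x1; x']) cl (w := k)) => //.
- rewrite inE eq_sym negb_or kk' /=; by apply/negP => /sK; rewrite kK.
- rewrite /= !inE negb_or x1x' !andbT.
  by apply/andP; split; apply: contraTneq k'K => ->; rewrite ?(complete_notin xK) ?sK.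
- have x1s : x1 \in s by rewrite memS eqxx.
  move: (s) x1s x'ne => s' x1s x's' a; rewrite !inE.
  by case/or3P=> /eqP->; rewrite ?eqxx ?x1s ?x's' ?orbT.
- rewrite /= kx' [adj k x1]adj_sym (forall_inP xK) //= andbT.
  by apply: Kc => //; rewrite eq_sym.
Qed.

End NoCliqueCutset.

(** * The cliques around a vertex and the components far from it *)

Section LocalConnectivity.
Variable G : sgraph.
Implicit Types (a b c d r x y z u w : G) (s t p q : seq G).

Variable v : G.
Hypotheses (tf : free_of is_theta G) (wf : free_of is_wheel G).
Hypotheses (cc : clique_connected G) (df : diamond_free G).

(** For [a] adjacent to [v] in a diamond-free graph, this is the unique maximal clique containing
    both. *)
Definition nbr_clique a : {set G} :=
  [set u | ((u == v) || adj u v) && ((u == a) || adj u a)].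

Definition far u := (u != v) && ~~ adj u v.

Definition far_adj x y := [&& far x, far y & adj x y].

Definition attached a x := [exists u in nbr_clique a, adj u x].

(** The clique may contain [v], but [v] has no far neighbour; so the witness is a neighbour of
    [v]. *)
Lemma attachedP a x : far x ->
  reflect (exists u, [/\ u \in nbr_clique a, adj u v & adj u x]) (attached a x).
Proof.
case/andP=> _ nxv; apply: (iffP exists_inP) => [[u uK ux]|[u [uK uv ux]]].
  exists u; split=> //; move: (uK); rewrite inE => /andP[/predU1P[uv|//] _].
  by move: nxv; rewrite -uv adj_sym ux.
by exists u.
Qed.

Lemma mem_nbr_clique a : adj a v -> a \in nbr_clique a.
Proof. by move=> av; rewrite inE eqxx av orbT. Qed.

Lemma v_nbr_clique a : adj a v -> v \in nbr_clique a.
Proof. by move=> av; rewrite inE eqxx adj_sym av orbT. Qed.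

Lemma far_nbr_clique a x : far x -> x \notin nbr_clique a.
Proof. by case/andP=> xv nxv; rewrite inE (negbTE xv) (negbTE nxv). Qed.

Lemma nbr_clique_clique a : adj a v -> clique (nbr_clique a).
Proof.
move=> av x y /[!inE] /andP[xv xa] /andP[yv ya].
have [->|nxv] := eqVneq x v.
  by rewrite eq_sym adj_sym => yv'; rewrite (negbTE yv') in yv.
have [->|nyv] := eqVneq y v; first by rewrite (negbTE nxv) in xv.
rewrite (negbTE nxv) in xv; rewrite (negbTE nyv) in yv.
have [->|nxa] := eqVneq x a.
  by rewrite eq_sym adj_sym => ya'; rewrite (negbTE ya') in ya.
have [->|nya] := eqVneq y a; first by rewrite (negbTE nxa) in xa.
rewrite (negbTE nxa) in xa; rewrite (negbTE nya) in ya.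
exact: df av xa xv ya yv.
Qed.

(** If [u] were adjacent to [b], then [u] and [a] would be common neighbours of the edge [bv], hence
    adjacent, putting [u] in the clique of [a]. Thus distinct cliques around [v] have no edges
    between them outside [v]. *)
Lemma nbr_clique_nadj a b u : adj a v -> b \in nbr_clique a -> adj b v ->
  adj u v -> u \notin nbr_clique a -> adj u b = false.
Proof.
move=> av + bv uv; rewrite !inE bv uv !orbT /= negb_or.
case/predU1P=> [->|ba] /andP[ua nua]; first exact: negbTE.
apply: contraNF nua => ub; rewrite adj_sym in ba.
by apply: (df _ ub uv ba av ua); rewrite ?bv.
Qed.

Lemma connect_far_path x p :
  path adj x p -> far x -> {in p, forall u, far u} -> connect far_adj x (last x p).
Proof.
elim: p x => [|y p IH] x /=; first by rewrite connect0.
case/andP=> xy py fx fp; have fy : far y by apply: fp; rewrite mem_head.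
apply: (connect_trans (connect1 _) (IH y py fy _)).
  by rewrite /far_adj fx fy.
by move=> u up; apply: fp; rewrite inE up orbT.
Qed.

(* Otherwise a shortest path between the two components, closed up through the
   clique of [a], is a hole in which [v] has two nonadjacent neighbours. *)
Lemma attached_connect a x y : adj a v -> far x -> far y ->
  attached a x -> attached a y -> connect far_adj x y.
Proof.
move=> av fx fy.
have [p [ip lp pK]] := cc (nbr_clique_clique av)
  (far_nbr_clique a fx) (far_nbr_clique a fy).
rewrite -{y}lp in fy *.
elim: {p}(size p).+1 {-2}p (ltnSn (size p)) x ip pK fx fy => // n IH.
case/lastP=> [|p y]; first by move=> *; rewrite connect0.
move=> sp x; rewrite last_rcons => ip pK fx fy ax ay.
rewrite size_rcons ltnS in sp.
have [/allP fp|] := boolP (all far p).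
  rewrite -(last_rcons x p y); apply: connect_far_path (ipath_path ip) fx _.
  by move=> u; rewrite mem_rcons inE => /predU1P[->|/fp].
case/allPn=> z zp nfz.
(* A far inner vertex attached to [a] splits the path into two shorter ones, to which induction
   applies. *)
have [/hasP[u up /andP[fu au]]|nfp] := boolP (has (fun u => far u && attached a u) p).
  have [p1 [p2 E]] : exists p1 p2, p = p1 ++ u :: p2.
    by case/splitPr: up => p1 p2; exists p1, p2.
  rewrite E size_cat /= in sp.
  apply: (@connect_trans _ _ u).
    rewrite -[u in connect _ _ u](last_rcons x p1 u).
    apply: IH; rewrite ?last_rcons ?size_rcons //.
    - by apply: leq_ltn_trans sp; rewrite addnS ltnS leq_addr.
    - by apply: (@ipath_prefix _ (x :: p1) u (rcons p2 y)); move: ip; rewrite E rcons_cat.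
    - move=> b; rewrite mem_rcons inE => bp; apply: pK.
      by rewrite mem_rcons inE E mem_cat inE; case/orP: bp => ->; rewrite !orbT.
  rewrite -[y in connect _ _ y](last_rcons u p2 y).
  apply: IH; rewrite ?last_rcons ?size_rcons //.
  - by apply: leq_ltn_trans sp; rewrite leq_addl.
  - by move: ip; rewrite E rcons_cat -cat_cons => /ipath_catP[].
  - move=> b; rewrite mem_rcons inE => bp; apply: pK.
    by rewrite mem_rcons inE E mem_cat inE; case/orP: bp => ->; rewrite ?orbT.
have pK' u : u \in p -> u \notin nbr_clique a.
  by move=> up; apply: pK; rewrite mem_rcons inE up orbT.
have pv u : u \in p -> u != v.
  by move=> /pK'; apply: contraNneq => ->; apply: v_nbr_clique.
have zv : adj z v by move: nfz; rewrite /far pv // negbK.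
(* Inner vertices adjacent to [v] lie in other cliques around [v], and the far ones are not attached
   to [a]; either way they miss the clique of [a]. *)
have pnadj b u : b \in nbr_clique a -> adj b v -> u \in p -> adj b u = false.
  move=> bK bv up; have := hasPn nfp _ up; rewrite /far (pv u up) /=.
  have [uv _|nuv /= nau] := boolP (adj u v).
    by rewrite adj_sym; apply: nbr_clique_nadj bK bv uv (pK' _ up).
  by apply: contraNF nau => bu; apply/exists_inP; exists b.
have [p1 [p2 E]] : exists p1 p2, p = p1 ++ z :: p2.
  by case/splitPr: zp => p1 p2; exists p1, p2.
have vR b : b \in nbr_clique a -> b \notin x :: rcons p y.
  move=> bK; rewrite inE mem_rcons inE !negb_or.
  apply/and3P; split.
  - by apply: contraTneq bK => ->; apply: far_nbr_clique.
  - by apply: contraTneq bK => ->; apply: far_nbr_clique.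
  - by apply: contraL bK => /pK'.
have RE t : rcons p y ++ t = p1 ++ z :: rcons p2 y ++ t by rewrite E rcons_cat -catA.
have vK := v_nbr_clique av.
have xnp : x \notin rcons p y by case/ipath_consP: ip.
have xy : x != y by apply: contraNneq xnp => ->; rewrite mem_rcons mem_head.
have xp : {in p, forall u, u != x}.
  by move=> u up; apply: contraNneq xnp => <-; rewrite mem_rcons inE up orbT.
have yp : {in p, forall u, u != y}.
  have := ipath_uniq ip; rewrite /= rcons_uniq => /and3P[_ ynp _] u up.
  by apply: contraNneq ynp => <-.
(* The path is closed by one clique vertex [d] adjacent to both its ends, or, failing that, by two
   clique vertices [b] and [c], one at each end. Then [v] is adjacent to [d], respectively [b], and
   to the inner vertex [z]. *)
have [/exists_inP[d dK /andP[dx dy]]|nd] :=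
    boolP [exists d in nbr_clique a, adj d x && adj d y].
  have dv : adj d v.
    move: dK; rewrite inE => /andP[/predU1P[dv|//] _].
    by case/andP: fx => _; rewrite adj_sym -dv dx.
  have cl : closing d ((x :: p1) ++ z :: rcons p2 y).
    rewrite cat_cons -[rcons p2 y]cats0 -RE cats0; split=> //.
    - by rewrite /= size_rcons ltnS; case: (p) zp.
    - exact: vR.
    - move=> u; rewrite inE mem_rcons inE /= last_rcons.
      case/or3P=> [/eqP->|/eqP->|up].
      + by rewrite dx eqxx.
      + by rewrite dy eqxx orbT.
      + by rewrite (pnadj d) // (negbTE (xp _ up)) (negbTE (yp _ up)).
  case: (closing_interior_adj tf wf (w := v) cl); rewrite ?size_rcons //.
  - rewrite inE negb_or cat_cons -[rcons p2 y]cats0 -RE cats0 vR // andbT.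
    by apply: contraTneq dv => <-; rewrite adj_irrefl.
  - by rewrite adj_sym.
  - by rewrite adj_sym.
have /(attachedP _ fx)[b [bK bv bx]] := ax.
have /(attachedP _ fy)[c [cK cv cy]] := ay.
have nby : adj b y = false.
  by apply: contraNF nd => by_; apply/exists_inP; exists b; rewrite ?bx.
have ncx : adj c x = false.
  by apply: contraNF nd => cx; apply/exists_inP; exists c; rewrite ?cx.
have bc : b != c by apply: contraFneq ncx => <-.
have cl : closing b ((x :: p1) ++ z :: rcons p2 y ++ [:: c]).
  rewrite cat_cons -RE; split=> //.
  - rewrite -cat_cons; apply/ipath_catP; split=> // u w uR /[!inE] /eqP->.
    split; first by apply: contraTneq uR => ->; apply: vR.
    rewrite /= last_rcons eqxx andbT; move: uR; rewrite inE mem_rcons inE adj_sym.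
    case/or3P=> [/eqP->|/eqP->|up].
    + by rewrite ncx (negbTE xy).
    + by rewrite cy eqxx.
    + by rewrite (pnadj c) // (negbTE (yp _ up)).
  - by rewrite /= size_cat size_rcons addn1.
  - by rewrite -cat_cons mem_cat mem_seq1 negb_or bc vR.
  - move=> u; rewrite inE mem_cat mem_rcons !inE /= last_cat /=.
    have Rc w : w \in x :: rcons p y -> (w == c) = false.
      by move=> wR; apply/negbTE; apply: contraTneq wR => ->; apply: vR.
    case/or3P=> [/eqP->|/predU1P[->|up]|/eqP->].
    + by rewrite bx eqxx.
    + rewrite nby eq_sym (negbTE xy) Rc //.
      by rewrite inE mem_rcons mem_head orbT.
    + rewrite (pnadj b) // (negbTE (xp _ up)) Rc //.
      by rewrite inE mem_rcons inE up !orbT.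
    + by rewrite eqxx orbT; apply: (nbr_clique_clique av).
case: (closing_interior_adj tf wf (w := v) cl); rewrite ?size_cat ?size_rcons //.
- have -> : (x :: p1) ++ z :: rcons p2 y ++ [:: c] = (x :: rcons p y) ++ [:: c].
    by rewrite cat_cons -RE.
  rewrite in_cons mem_cat mem_seq1 2!negb_or vR //=.
  apply/andP; split.
    by apply: contraTneq bv => <-; rewrite adj_irrefl.
  by apply: contraTneq cv => <-; rewrite adj_irrefl.
- by rewrite adj_sym.
- by rewrite adj_sym.
Qed.

(** A path from [a] to [b] avoiding [v] leaves the clique of [a] at some [x], which is far because
    distinct cliques around [v] have no edges between them. The component of [x] is then propagated
    along a path from [a] to any [d], again avoiding [v]. *)
Lemma attached_all a b : adj a v -> adj b v -> b \notin nbr_clique a ->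
  exists2 x, far x & forall d, adj d v ->
    exists y, [/\ far y, connect far_adj x y & attached d y].
Proof.
move=> av bv ba.
have cv d : adj d v -> exists p,
    [/\ ipath (a :: p), last a p = d & {in p, forall u, u \notin [set v]}].
  move=> dv; apply: cc; first by move=> x y /set1P-> /set1P->; rewrite eqxx.
    by rewrite inE; apply: contraTneq av => ->; rewrite adj_irrefl.
  by rewrite inE; apply: contraTneq dv => ->; rewrite adj_irrefl.
have [x fx ax] : exists2 x, far x & attached a x.
  have [p [ip lp pv]] := cv _ bv.
  have [||u [x [up xp uK xK ux]]] :=
    path_exit (P := mem (nbr_clique a)) (ipath_path ip).
  - exact: mem_nbr_clique.
  - by rewrite lp.
  have xv : x != v by have := pv _ xp; rewrite inE.
  have uv : adj u v.
    move: (uK); rewrite /= inE => /andP[/predU1P[uv|//] _].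
    move: up; rewrite uv inE => /predU1P[va|/pv].
      by rewrite -va adj_irrefl in av.
    by rewrite inE eqxx.
  have fx : far x.
    rewrite /far xv; apply: contraTN ux => xv'.
    by rewrite adj_sym (nbr_clique_nadj av uK uv).
  by exists x => //; apply/exists_inP; exists u.
exists x => // d dv; have [p [ip lp pv]] := cv _ dv.
(* The invariant along the path: a neighbour of [v] has its clique attached to the component of [x],
   and a far vertex lies in that component. It is shown to survive every edge, by [attached_connect]
   when passing from a neighbour of [v] to a far vertex. *)
pose U u := if adj u v then [exists y, [&& far y, connect far_adj x y & attached u y]]
            else connect far_adj x u.
suff : U d by rewrite /U dv => /existsP[y /and3P[]]; exists y.
rewrite -lp; apply: contraT => nUd.
have [|u [w [up wp Uu nUw uw]]] := path_exit (P := U) (ipath_path ip) _ nUd.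
  by rewrite /U av; apply/existsP; exists x; rewrite fx connect0.
have wv : w != v by have := pv _ wp; rewrite inE.
have uv : u != v.
  move: up; rewrite inE => /predU1P[->|/pv]; last by rewrite inE.
  by apply: contraTneq av => ->; rewrite adj_irrefl.
case/negP: nUw; move: Uu; rewrite /U.
case: (boolP (adj u v)) => [auv /existsP[y /and3P[fy xy uy]]|nuv xu].
  have [awv|nwv] := boolP (adj w v); last first.
    have fw : far w by rewrite /far wv.
    apply: (connect_trans xy); apply: (attached_connect auv fy fw uy).
    by apply/exists_inP; exists u; rewrite ?mem_nbr_clique.
  apply/existsP; exists y; rewrite fy xy /=.
  have /(attachedP _ fy)[b' [bK bv' by_]] := uy.
  apply/exists_inP; exists b' => //.
  have wK : w \in nbr_clique u by rewrite inE awv adj_sym uw !orbT.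
  rewrite inE bv' orbT /=; have [//|nb] := eqVneq b' w.
  exact: (nbr_clique_clique auv).
have fu : far u by rewrite /far uv.
have [awv|nwv] := boolP (adj w v).
  apply/existsP; exists u; rewrite fu xu /=.
  by apply/exists_inP; exists w; rewrite ?mem_nbr_clique // adj_sym.
apply: (connect_trans xu); apply: connect1.
by rewrite /far_adj fu /far wv nwv.
Qed.

End LocalConnectivity.

(** * A claw whose leaves attach to one connected set *)

Section AttachedClaw.
Variable G : sgraph.
Implicit Types (a b c r t u v w x y z : G) (p q s : seq G) (C : pred G).

Lemma ipath_rcons s x :
  ipath s -> x \notin s -> {in s, forall u, adj u x = (u == last u s)} ->
  ipath (rcons s x).
Proof.
move=> ips xs xA; rewrite -cats1; apply/ipath_catP; split=> // u y us /[!inE] /eqP->.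
by rewrite eqxx andbT xA //; split=> //; apply: contraNneq xs => <-.
Qed.

Definition connected_in C := forall x y, C x -> C y ->
  exists p, [/\ path adj x p, last x p = y & {in p, forall u, C u}].

Lemma ipath_through C a b x y : connected_in C -> a != b ->
  C x -> C y -> adj a x -> adj b y ->
  exists2 p, ipath (a :: rcons p b) & {in p, forall u, C u}.
Proof.
move=> cC ab Cx Cy ax yb; have [s [ps ls sC]] := cC x y Cx Cy.
have [] := @walk_ipath G a (rcons (x :: s) b).
  by rewrite rcons_cons /= ax rcons_path ps ls adj_sym.
case/lastP=> [|p b'] [ip]; rewrite !last_rcons /=.
  by move=> ab'; rewrite ab' eqxx in ab.
move=> b'E pS; rewrite {}b'E in ip pS.
exists p => // u up; have := pS u; rewrite !(mem_rcons, inE) up orbT => /(_ isT).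
case/or3P=> [/eqP->//|/eqP ub|/sC//].
have := ipath_uniq ip.
by rewrite cons_uniq rcons_uniq -ub up andbF.
Qed.

Variable v : G.
Hypotheses (tf : free_of is_theta G) (wf : free_of is_wheel G).

(** The inner vertices are far from [v], so [v] sees only the ends; these being nonadjacent, the
    path has at least three vertices. *)
Lemma far_closing C a b p : {in C, forall u, far v u} ->
  adj v a -> adj v b -> ~~ adj a b -> a != b ->
  ipath (a :: rcons p b) -> {in p, forall u, C u} -> closing v (a :: rcons p b).
Proof.
move=> Cfar va vb nab ab ip pC.
have pv u : u \in p -> u != v /\ adj v u = false.
  by move/pC/Cfar/andP=> [uv nuv]; rewrite adj_sym (negbTE nuv).
split=> //.
- rewrite /= size_rcons !ltnS; case: p ip {pC pv} => // /ipath_path.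
  by rewrite /= (negbTE nab).
- rewrite inE mem_rcons inE !negb_or; apply/and3P; split.
  + by apply: contraTneq va => <-; rewrite adj_irrefl.
  + by apply: contraTneq vb => <-; rewrite adj_irrefl.
  + by apply/negP=> /pv[]; rewrite eqxx.
- move=> u; rewrite inE mem_rcons inE /= last_rcons => /or3P[/eqP->|/eqP->|up].
  + by rewrite va eqxx.
  + by rewrite vb eqxx orbT.
  + have [_ ->] := pv u up; apply/esym/negbTE; rewrite negb_or.
    have := ipath_uniq ip; rewrite /= mem_rcons inE negb_or rcons_uniq.
    case/and3P=> /andP[_ anp] bnp _.
    by apply/andP; split; [apply: contraNneq anp => <- | apply: contraNneq bnp => <-].
Qed.

(* Every chordless path from [c] to [b] through the given vertices contains
   [d], and closes up with [v] to a hole to which [a] attaches at [v] and [d]. *)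
Lemma first_neighbour_contra C a b c p q1 d q2 t :
  {in C, forall u, far v u} -> adj v a -> adj v b -> adj v c ->
  a != b -> a != c -> b != c -> ~~ adj b c ->
  path adj a (rcons p b) -> {in p, forall u, C u} ->
  ipath (c :: rcons (q1 ++ d :: q2) t) ->
  {in rcons (q1 ++ d :: q2) t, forall u, C u} ->
  has (adj t) p ->
  {in c :: q1, forall u, ~~ has (adj u) p} ->
  {in q1, forall u, ~~ adj u b} ->
  adj a d -> False.
Proof.
move=> Cfar va vb vc ab ac bc nbc pp pC iq qC /hasP[r rp tr] q1p q1b as_.
have vC u : adj v u -> C u = false.
  by move=> vu; apply/negP=> /Cfar/andP[_]; rewrite adj_sym vu.
have [p1 [p2 pE]] : exists p1 p2, p = p1 ++ r :: p2.
  by case/splitPr: rp => p1 p2; exists p1, p2.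
have [] := @walk_ipath G c (rcons (q1 ++ d :: q2) t ++ r :: rcons p2 b).
  rewrite cat_path ipath_path //= last_rcons tr.
  by move: pp; rewrite pE rcons_cat cat_path /= => /and3P[].
case/lastP=> [|R b'] [iR]; rewrite last_cat /= !last_rcons.
  by move=> cb; rewrite cb eqxx in bc.
move=> b'E RS; rewrite {}b'E in iR RS.
have bR : b \notin R by have := ipath_uniq iR; rewrite /= rcons_uniq => /and3P[].
have RC : {in R, forall u, C u}.
  move=> u uR; have := RS u; rewrite mem_rcons inE uR orbT => /(_ isT).
  rewrite mem_cat inE mem_rcons inE mem_rcons inE => /orP[uq|/or3P[/eqP->|/eqP ub|up]].
  - by apply: qC; rewrite mem_rcons inE.
  - exact: pC.
  - by rewrite -ub uR in bR.
  - by apply: pC; rewrite pE mem_cat inE up !orbT.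
have sC : C d by apply: qC; rewrite mem_rcons inE mem_cat mem_head !orbT.
(* [R] has to leave [c :: q1]. No vertex there is adjacent to [p] or to [b], and since the path from
   [c] to [t] is induced, the exit can only be at [d]. *)
have sR : d \in R.
  have [||u [w [uR wR uq nwq uw]]] :=
    path_exit (P := mem (c :: q1)) (ipath_path iR).
  - exact: mem_head.
  - rewrite last_rcons /= inE (negbTE bc) /=; apply/negP=> bq.
    by have := vC b vb; rewrite qC // mem_rcons inE mem_cat bq orbT.
  rewrite /= in uq nwq.
  have := RS w wR; rewrite mem_cat => /orP[wq|wp].
    have ws : w \in d :: rcons q2 t.
      have : w \in (c :: q1) ++ d :: rcons q2 t.
        by rewrite cat_cons inE -rcons_cons -rcons_cat wq orbT.
      by rewrite mem_cat (negbTE nwq).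
    move: iq; rewrite rcons_cat -cat_cons => /ipath_catP[_ _ /(_ u w uq ws)[_]].
    rewrite uw => /esym/andP[_ /eqP /= wE].
    move: wR; rewrite wE mem_rcons inE => /predU1P[sb|//].
    by have := vC b vb; rewrite -sb sC.
  move: wp; rewrite -rcons_cons mem_rcons inE => /predU1P[wb|wp].
    move: uq uw; rewrite wb inE => /predU1P[->|/q1b/negbTE->//].
    by rewrite adj_sym (negbTE nbc).
  have wp' : w \in p by rewrite pE mem_cat wp orbT.
  by case/hasP: (q1p u uq); exists w.
have [R1 [R2 RE]] : exists R1 R2, R = R1 ++ d :: R2.
  by case/splitPr: sR => R1 R2; exists R1, R2.
have cb : c != b by rewrite eq_sym.
have cl : closing v ((c :: R1) ++ d :: rcons R2 b).
  rewrite cat_cons -rcons_cons -rcons_cat -RE.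
  by apply: far_closing iR RC; rewrite // adj_sym.
have Ca := vC a va.
case: (closing_interior_adj tf wf (w := a) cl); rewrite ?size_rcons //.
- rewrite cat_cons -rcons_cons -rcons_cat -RE !inE mem_rcons inE !negb_or ab ac /=.
  apply/andP; split; first by apply: contraTneq va => ->; rewrite adj_irrefl.
  by apply/negP=> /RC; rewrite /= Ca.
- by rewrite adj_sym.
Qed.

Hypothesis pf : free_of is_pyramid G.

(** A path [p] from [a] to [b] through [C] closes with [v] to a hole, and [c] has no neighbour in
    [p]. Let [t] be the first vertex with a neighbour in [p] on a path from [c] through [C]; the
    vertices before it are anticomplete to [a], [p] and [b]. If [t] has one neighbour on the path
    from [a] to [b], there is a theta between [v] and that neighbour; if its first and last
    neighbours are nonadjacent, a theta between [v] and [t]; if they are consecutive, a pyramid with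
    apex [v]. *)
Lemma attached_claw_contra C a b c xa xb xc :
  {in C, forall u, far v u} -> connected_in C ->
  adj v a -> adj v b -> adj v c -> a != b -> a != c -> b != c ->
  ~~ adj a b -> ~~ adj a c -> ~~ adj b c ->
  C xa -> C xb -> C xc -> adj a xa -> adj b xb -> adj c xc -> False.
Proof.
move=> Cfar cC va vb vc ab ac bc nab nac nbc Ca Cb Cc axa bxb cxc.
have vC u : adj v u -> C u = false.
  by move=> vu; apply/negP=> /Cfar/andP[_]; rewrite adj_sym vu.
have [p ip pC] := ipath_through cC ab Ca Cb axa bxb.
have cl := far_closing Cfar va vb nab ab ip pC.
have [ipL szL vL vLA] := cl.
have cL : c \notin a :: rcons p b.
  rewrite inE mem_rcons inE !negb_or eq_sym ac eq_sym bc /=.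
  by apply/negP=> /pC; rewrite /= vC.
have vne u : adj v u -> v != u.
  by move=> vu; apply: contraTneq vu => <-; rewrite adj_irrefl.
have ncp : ~~ has (adj c) p.
  apply/hasP=> -[r rp cr].
  have [p1 [p2 pE]] : exists p1 p2, p = p1 ++ r :: p2.
    by case/splitPr: rp => p1 p2; exists p1, p2.
  have LE : (a :: p1) ++ r :: rcons p2 b = a :: rcons p b by rewrite pE rcons_cat.
  apply: (closing_interior_adj tf wf (w := c) (z := v) (p := a :: p1) (r := r)
           (q := rcons p2 b)); rewrite ?LE ?size_rcons //.
  - by rewrite in_cons negb_or cL eq_sym vne.
  - by rewrite adj_sym.
pose T u := (u \in p) || has (adj u) p.
have cp : c \notin p.
  by apply: contra cL => cp; rewrite inE mem_rcons inE cp !orbT.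
have nTc : ~~ T c by rewrite /T negb_or cp ncp.
have [q0 [t [iq qC Tt nTq]]] : exists q0 t,
    [/\ ipath (c :: rcons q0 t), {in rcons q0 t, forall u, C u}, T t
      & {in c :: q0, forall u, ~~ T u}].
  have p0 : has predT p by move: szL; rewrite /= size_rcons; case: (p).
  have [d dp _] := hasP p0.
  have [s [ps ls sC]] := cC xc d Cc (pC d dp).
  have [] := @walk_ipath G c (xc :: s); first by rewrite /= cxc.
  move=> s' [is' ls' s'S].
  have s'C : {in s', forall u, C u}.
    by move=> u /s'S; rewrite inE => /predU1P[->|/sC].
  have : has T s'.
    apply/hasP; exists d; last by rewrite /T dp.
    move: (mem_last c s'); rewrite ls' /= ls inE => /predU1P[dc|//].
    by rewrite -dc dp in cp.
  case/split_first=> q0 [t [q1 [s'E Tt nq0]]]; exists q0, t; split=> //.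
  - by apply: (@ipath_prefix _ (c :: q0) t q1); rewrite cat_cons -s'E.
  - by move=> u uq; apply: s'C; rewrite s'E -cat_rcons mem_cat uq.
  - by move=> u; rewrite inE => /predU1P[->|/(hasPn nq0)].
have Ct : C t by apply: qC; rewrite mem_rcons mem_head.
(* Were [t] in [p], its predecessor would be adjacent to [p] and satisfy [T] earlier. *)
have tp : t \notin p.
  move: iq; rewrite -cats1 -cat_cons => /ipath_catP[_ _ /(_ (last c q0) t)].
  rewrite mem_last mem_seq1 eqxx => /(_ isT isT)[_]; rewrite /= !eqxx /= => qt.
  apply: contra (nTq _ (mem_last c q0)) => tp; apply/orP; right.
  by apply/hasP; exists t.
have {Tt} tP : has (adj t) p by move: Tt; rewrite /T (negbTE tp).
have nqp : {in c :: q0, forall u, ~~ has (adj u) p}.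
  by move=> u /nTq; rewrite negb_or => /andP[].
(* The first vertex of [q0] adjacent to [a] or [b] serves as [d] in [first_neighbour_contra]; for
   [b], the roles of [a] and [b] are exchanged and [p] is reversed. *)
have nab_q : ~~ has (fun u => adj u a || adj u b) q0.
  apply/negP=> /split_first[q1 [s [q2 [q0E sab nq1]]]].
  rewrite q0E in iq qC nqp.
  have nqp1 : {in c :: q1, forall u, ~~ has (adj u) p}.
    by move=> u uq; apply: nqp; rewrite -cat_cons mem_cat uq.
  case/orP: sab => [sa|sb].
    apply: (first_neighbour_contra Cfar va vb vc ab ac bc nbc (ipath_path ip) pC iq) => //.
      by move=> u /(hasPn nq1); rewrite negb_or => /andP[].
    by rewrite adj_sym.
  apply: (first_neighbour_contra Cfar vb va vc _ bc ac nac _ _ iq (p := rev p)) => //.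
  - by rewrite eq_sym.
  - apply: ipath_path; rewrite -rcons_cons -rev_rcons -rev_cons.
    by rewrite ipath_rev.
  - by move=> u; rewrite mem_rev; apply: pC.
  - by rewrite has_rev.
  - by move=> u /nqp1; rewrite has_rev.
  - by move=> u /(hasPn nq1); rewrite negb_or => /andP[].
  - by rewrite adj_sym.
have tL : t \notin a :: rcons p b.
  rewrite inE mem_rcons inE !negb_or tp andbT.
  by apply/andP; split; apply: contraTneq Ct => ->; rewrite vC.
have qL : anticomplete (c :: q0) (a :: rcons p b).
  move=> x y xq yL; split.
    apply: contraNneq (nTq x xq) => xy; rewrite -xy in yL.
    move: yL; rewrite inE mem_rcons inE.
    have xC : x != c -> C x.
      move: xq; rewrite inE => /predU1P[->|xq _]; first by rewrite eqxx.
      by apply: qC; rewrite mem_rcons inE xq orbT.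
    case/or3P=> [/eqP Ea|/eqP Eb|xp]; last by rewrite /T xp.
    + by have := xC; rewrite Ea vC // => /(_ ac).
    + by have := xC; rewrite Eb vC // => /(_ bc).
  move: yL; rewrite inE mem_rcons inE => /or3P[/eqP->|/eqP->|yp].
  - move: xq; rewrite inE => /predU1P[->|xq]; first by rewrite adj_sym (negbTE nac).
    by apply/negbTE; have := hasPn nab_q x xq; rewrite negb_or => /andP[].
  - move: xq; rewrite inE => /predU1P[->|xq]; first by rewrite adj_sym (negbTE nbc).
    by apply/negbTE; have := hasPn nab_q x xq; rewrite negb_or => /andP[].
  - exact/negbTE/(hasPn (nqp x xq)).
have vq u : u \in rcons q0 t -> (adj v u = false) * (u == c = false).
  move=> uq; have /andP[_ nuv] := Cfar u (qC u uq); rewrite adj_sym (negbTE nuv).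
  by split=> //; apply/negbTE; apply: contraTneq (qC u uq) => ->; rewrite vC.
have ivq : ipath (v :: c :: rcons q0 t).
  apply/ipath_consP; split=> //.
    rewrite inE negb_or vne //=; apply/negP=> /qC/Cfar/andP[].
    by rewrite eqxx.
  move=> u; rewrite inE => /predU1P[->|uq]; first by rewrite vc eqxx.
  by rewrite !vq.
have : has (adj t) (a :: rcons p b).
  case/hasP: tP => d dp td; apply/hasP; exists d => //.
  by rewrite inE mem_rcons inE dp !orbT.
case/split_first=> A [u [B [LE tu nA]]].
have rcl := closing_rev cl.
have clA : 0 < size B -> ipath (v :: rcons A u).
  move=> B0; apply: (closing_prefix (q := B)); rewrite ?size_rcons //.
  by rewrite cat_rcons -LE.
have uL : u \in a :: rcons p b by rewrite LE mem_cat mem_head orbT.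
(* With a single neighbour [u], the neighbour of [t] in [p] must be [u] itself; so [u] is inner and
   both sides [A] and [B] are nonempty. *)
have [|nB] := boolP (has (adj t) B); last first.
  have up : u \in p.
    case/hasP: tP => d dp td.
    have : d \in a :: rcons p b by rewrite inE mem_rcons inE dp !orbT.
    rewrite LE mem_cat inE => /or3P[dA|/eqP<-//|dB].
      by have := hasPn nA d dA; rewrite td.
    by have := hasPn nB d dB; rewrite td.
  have := ipath_uniq ipL; rewrite /= mem_rcons inE negb_or rcons_uniq.
  case/and3P=> /andP[_ anp] bnp _.
  have A0 : 0 < size A.
    case: (A) LE => //= -[au _]; by rewrite au up in anp.
  have B0 : 0 < size B.
    case: (B) LE => //; rewrite cats1 -rcons_cons => /rcons_inj[_ bu].
    by rewrite bu up in bnp.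
  have AB : anticomplete A B by move: ipL; rewrite LE => /ipath_anticomplete.
  have AL : {subset A <= a :: rcons p b} by move=> x xA; rewrite LE mem_cat xA.
  have BL : {subset B <= a :: rcons p b}.
    by move=> x xB; rewrite LE mem_cat inE xB !orbT.
  have tqL X : {subset X <= a :: rcons p b} -> ~~ has (adj t) X ->
      anticomplete (c :: rcons q0 t) X.
    move=> XL nX x y; rewrite -rcons_cons mem_rcons inE => /predU1P[->|xq] yX.
      split; last exact/negbTE/(hasPn nX).
      by apply: contraNneq tL => ->; apply: XL.
    by apply: qL => //; apply: XL.
  apply: (theta_free_paths tf (a := v) (b := u) (p := c :: rcons q0 t)
           (q := A) (r := rev B)); rewrite ?size_rev //.
  - rewrite -rcons_cons; apply: ipath_rcons => //.
      rewrite inE negb_or; apply/andP; split.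
        by apply: contraNneq vL => <-.
      rewrite -rcons_cons mem_rcons inE negb_or; apply/andP; split.
        by apply: contraNneq tL => <-.
      by apply/negP=> uq; have [] := qL u u uq uL; rewrite eqxx.
    have uvt : v != t by have /andP[] := Cfar t Ct; rewrite eq_sym.
    move=> x; rewrite -rcons_cons inE mem_rcons inE [last _ _]/= last_rcons.
    case/or3P=> [/eqP->|/eqP->|xq].
    + by rewrite (negbTE uvt); have /andP[_] := Cfar u (pC u up); rewrite adj_sym => /negbTE.
    + by rewrite eqxx tu.
    + have [_ ->] := qL x u xq uL; apply/esym/negbTE.
      apply: contraNneq (nTq x xq) => ->.
      by rewrite /T tP orbT.
  - exact: clA.
  - apply: (closing_prefix (q := rev A)); rewrite ?size_rcons ?size_rev //.
    by rewrite LE rev_cat rev_cons in rcl.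
  - exact: tqL.
  - by apply: tqL; rewrite ?has_rev // => x; rewrite mem_rev => /BL.
  - by apply: anticomplete_sub AB _ _ => // x; rewrite mem_rev.
case/split_last=> M [u' [B' [BE tu' nB']]].
have u'L : u' \in a :: rcons p b by rewrite LE BE mem_cat inE mem_cat mem_head !orbT.
have AL : {subset rcons A u <= a :: rcons p b}.
  by move=> x xA; rewrite LE -cat_rcons mem_cat xA.
have BL : {subset rcons (rev B') u' <= a :: rcons p b}.
  move=> x; rewrite mem_rcons inE mem_rev LE BE mem_cat inE mem_cat [x \in u' :: _]inE.
  by case/orP=> ->; rewrite !orbT.
have ivA : ipath (v :: rcons A u) by apply: clA; rewrite BE size_cat addnS.
have ivB : ipath (v :: rcons (rev B') u').
  apply: (closing_prefix (q := rev M ++ u :: rev A));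
    rewrite ?size_rcons ?size_cat ?addnS //.
  by move: rcl; rewrite LE BE rev_cat rev_cons rev_cat rev_cons !cat_rcons -catA.
(* [M] is the stretch strictly between the first and last neighbours [u] and [u'] of [t]. If it is
   nonempty, it is left out of the theta, whatever [t] sees there. *)
case: M BE => [|m M] BE; last first.
  have ext X w : ipath (v :: rcons X w) -> {subset rcons X w <= a :: rcons p b} ->
      adj t w -> ~~ has (adj t) X -> ipath (v :: rcons (rcons X w) t).
    move=> ivX XL tw nX; rewrite -rcons_cons; apply: ipath_rcons => //.
      rewrite inE negb_or (contra (XL t) tL) andbT.
      by have /andP[] := Cfar t Ct.
    move=> x; rewrite inE mem_rcons inE [last _ _]/= last_rcons.
    case/or3P=> [/eqP->|/eqP->|xX].
    + rewrite (negbTE (_ : v != w)).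
        by have /andP[_] := Cfar t Ct; rewrite adj_sym => /negbTE.
      by apply: contraNneq vL => ->; apply: XL; rewrite mem_rcons mem_head.
    + by rewrite adj_sym tw eqxx.
    + rewrite adj_sym (negbTE (hasPn nX x xX)); apply/esym/negbTE.
      by apply: contraTneq tw => <-; apply: (hasPn nX).
  apply: (theta_free_paths tf (a := v) (b := t) (p := c :: q0)
           (q := rcons A u) (r := rcons (rev B') u')); rewrite ?size_rcons //.
  - exact: ext.
  - by apply: ext; rewrite ?has_rev.
  - by apply: anticomplete_sub qL _ AL.
  - by apply: anticomplete_sub qL _ BL.
  - have : ipath (rcons A u ++ m :: M ++ u' :: B') by rewrite cat_rcons -[m :: _]BE -LE.
    move/ipath_anticomplete/anticomplete_sub; apply=> // x.
    by rewrite mem_rcons inE mem_rev mem_cat inE => ->; rewrite orbT.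
rewrite /= in BE.
have : ipath (rcons A u ++ u' :: B') by rewrite cat_rcons -BE -LE.
case/ipath_catP=> _ _ AB.
apply: (pyramid_free_paths pf (a := v) (x := t) (y := u) (z := u')
  (p := c :: q0) (q := A) (r := rev B')) => //.
- split=> //; have [||_] := AB u u'; rewrite ?mem_head ?mem_rcons ?mem_head //.
  by rewrite last_rcons /= !eqxx.
- rewrite size_rev -ltnS -ltnS; have := szL.
  by rewrite LE BE size_cat /= !addnS.
- move=> x y; rewrite mem_rcons inE => /predU1P[->|xq] yA.
    split=> [|ty]; first by apply: contraNneq tL => ->; apply: AL.
    move: yA; rewrite mem_rcons inE => /predU1P[->//|yA].
    by have := hasPn nA y yA; rewrite ty.
  by have [ne ->] := qL x y xq (AL y yA).
- move=> x y; rewrite mem_rcons inE => /predU1P[->|xq] yB.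
    split=> [|ty]; first by apply: contraNneq tL => ->; apply: BL.
    move: yB; rewrite mem_rcons inE mem_rev => /predU1P[->//|yB].
    by have := hasPn nB' y yB; rewrite ty.
  by have [ne ->] := qL x y xq (BL y yB).
- move=> x y xA yB.
  have [|ne ->] := AB x y xA; first by move: yB; rewrite mem_rcons !inE mem_rev.
  by rewrite last_rcons /=; split=> // /andP[/eqP-> /eqP->].
Qed.

End AttachedClaw.

(** * Excluding claws *)

Section ClawFree.
Variable G : sgraph.
Hypotheses (tf : free_of is_theta G) (wf : free_of is_wheel G).
Hypotheses (pf : free_of is_pyramid G) (cc : clique_connected G).

Lemma far_adj_path (v x : G) p : path (far_adj v) x p ->
  path adj x p /\ {in p, forall u, far v u}.
Proof.
elim: p x => //= y p IH x /andP[/and3P[_ fy ->] /IH[-> fp]]; split=> // u.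
by rewrite inE => /predU1P[->|/fp].
Qed.

(** The leaves lie in different cliques around [v], all attached to one far component [C]. Each leaf
    is replaced by a vertex of its clique with a neighbour in [C]; the new leaves are pairwise
    nonadjacent by [nbr_clique_nadj]. *)
Lemma claw_contra (v a b c : G) :
  adj v a -> adj v b -> adj v c -> a != b -> a != c -> b != c ->
  ~~ adj a b -> ~~ adj a c -> ~~ adj b c -> False.
Proof.
move=> va vb vc ab ac bc nab nac nbc.
have df := wheel_free_diamond_free wf cc.
have nK d e : adj v e -> d != e -> ~~ adj d e -> e \notin nbr_clique v d.
  move=> ve de nde; rewrite inE negb_and; apply/orP; right.
  by rewrite negb_or eq_sym de adj_sym.
have := attached_all tf wf cc df (a := a) (b := b) (v := v).
rewrite adj_sym va adj_sym vb nK // => /(_ isT isT isT)[x fx xall].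
pose C u := far v u && connect (far_adj v) x u.
have pick d : adj v d -> exists d' y,
    [/\ d' \in nbr_clique v d, adj d' v, C y & adj d' y].
  rewrite adj_sym => /xall[y [fy xy /(attachedP _ fy)[d' [dK dv dy]]]].
  by exists d', y; rewrite /C fy xy.
have [a' [xa [aK av Ca axa]]] := pick a va.
have [b' [xb [bK bv Cb bxb]]] := pick b vb.
have [c' [xc [cK cv Cc cxc]]] := pick c vc.
have sep d e d' e' : adj v d -> adj v e -> d != e -> ~~ adj d e ->
    d' \in nbr_clique v d -> e' \in nbr_clique v e -> adj d' v -> adj e' v ->
    d' != e' /\ ~~ adj d' e'.
  move=> vd ve de nde dK eK dv ev.
  have ned : adj e d' = false.
    by apply: (nbr_clique_nadj df _ dK dv); rewrite ?nK // adj_sym.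
  have d'K : d' \notin nbr_clique v e.
    rewrite inE negb_and; apply/orP; right; rewrite negb_or adj_sym ned andbT.
    by apply: contraNneq (nK d e ve de nde) => <-.
  split; first by apply: contraNneq d'K => ->.
  by rewrite (nbr_clique_nadj df _ eK ev) // adj_sym.
have [ab' nab'] := sep a b a' b' va vb ab nab aK bK av bv.
have [ac' nac'] := sep a c a' c' va vc ac nac aK cK av cv.
have [bc' nbc'] := sep b c b' c' vb vc bc nbc bK cK bv cv.
apply: (attached_claw_contra tf wf pf (v := v) (C := C) (a := a') (b := b') (c := c')
  (xa := xa) (xb := xb) (xc := xc)) => //; try by rewrite adj_sym.
- by move=> u /andP[].
move=> y z /andP[fy xy] /andP[fz xz].
have symF : symmetric (far_adj v).
  by move=> u w; rewrite /far_adj adj_sym andbCA.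
have : connect (far_adj v) y z.
  by apply: connect_trans xz; rewrite (sym_connect_sym symF).
case/connectP=> p pp ->; have [pa pfar] := far_adj_path pp.
exists p; split=> // u up; rewrite /C pfar //=.
by apply: (connect_trans xy); apply: (path_connect pp); rewrite inE up orbT.
Qed.

End ClawFree.

(** * Successors in a cyclic sequence *)

Lemma next_map_in (T T' : eqType) (g : T -> T') (s : seq T) :
  {in s &, injective g} -> uniq s ->
  {in s, forall x, next (map g s) (g x) = g (next s x)}.
Proof.
move=> gi us x xs; have ugs : uniq (map g s) by rewrite map_inj_in_uniq.
have iE : index (g x) (map g s) = index x s.
  rewrite -{1}(nth_index x xs) -(nth_map x (g x)) ?index_mem //.
  by rewrite index_uniq ?size_map ?index_mem.
rewrite !next_nth map_f // xs iE; case: s {gi us xs ugs iE} => //= y s.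
have [lt|ge] := ltnP (if y == x then 0 else (index x s).+1) (size s).
  by rewrite (nth_map y).
by rewrite !nth_default ?size_map.
Qed.

Lemma next_next_neq (T : eqType) (s : seq T) x :
  uniq s -> 2 < size s -> x \in s -> (next s x != x) && (next s (next s x) != x).
Proof.
move=> us s2 xs; have [i t E] := rot_to xs.
rewrite -!(next_rot i us) E; move: s2 us; rewrite -(size_rot i) -(rot_uniq i) E.
case: t {E} => [|y [|z t]] // _; rewrite cons_uniq !inE !negb_or.
case/andP=> /and3P[xy xz _] _.
have -> : next [:: x, y, z & t] x = y by rewrite /= eqxx.
have -> : next [:: x, y, z & t] y = z by rewrite /= [y == x]eq_sym (negbTE xy) eqxx.
by rewrite eq_sym xy eq_sym.
Qed.

(** * The root graph on maximal cliques *)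

Section RootGraph.
Variable G : sgraph.
Hypotheses (df : diamond_free G) (wf : free_of is_wheel G).
Hypothesis cf : forall v a b c : G,
  adj v a -> adj v b -> adj v c -> a != b -> a != c -> b != c ->
  ~~ adj a b -> ~~ adj a c -> ~~ adj b c -> False.
Implicit Types (u v w : G) (K : {set G}).

Definition maxclique K := maxset (@cliqueb G) K.

Lemma maxclique_clique K : maxclique K -> clique K.
Proof. by case/maxsetP=> /cliqueP. Qed.

Lemma maxclique_extend K : clique K -> exists2 M, maxclique M & K \subset M.
Proof. by move/cliqueP/maxset_exists=> [M]; exists M. Qed.

(** Any other vertices of [K] and [L] are common neighbours of the edge [uv], hence equal or
    adjacent; so the union of [K] and [L] is a clique and maximality equates all three. *)
Lemma maxclique_unique K L u v : maxclique K -> maxclique L -> u != v ->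
  u \in K -> v \in K -> u \in L -> v \in L -> K = L.
Proof.
move=> mK mL uv uK vK uL vL.
have cK := maxclique_clique mK; have cL := maxclique_clique mL.
have KL x y : x \in K -> y \in L -> x != y -> adj x y.
  move=> xK yL xy.
  have [xu|xu] := eqVneq x u; first by apply: cL; rewrite ?xu // -xu.
  have [xv|xv] := eqVneq x v; first by apply: cL; rewrite ?xv // -xv.
  have [yu|yu] := eqVneq y u; first by apply: cK; rewrite ?yu // -yu.
  have [yv|yv] := eqVneq y v; first by apply: cK; rewrite ?yv // -yv.
  by apply: (df (cK u v uK vK uv)); auto.
have cU : cliqueb (K :|: L).
  apply/cliqueP=> x y /setUP[xK|xL] /setUP[yK|yL] xy; auto.
  by rewrite adj_sym; apply: KL; rewrite // eq_sym.
have [_ /(_ _ cU (subsetUl _ _)) EK] := maxsetP mK.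
have [_ /(_ _ cU (subsetUr _ _)) EL] := maxsetP mL.
by rewrite -EK EL.
Qed.

Definition cliques_at v := [set K | maxclique K & v \in K].

Lemma cliques_at_gt0 v : 0 < #|cliques_at v|.
Proof.
have [|M mM vM] := @maxclique_extend [set v].
  by move=> x y /set1P-> /set1P->; rewrite eqxx.
by apply/card_gt0P; exists M; rewrite inE mM -sub1set.
Qed.

(** Three maximal cliques at [v] would give a claw: each has a vertex besides [v], and an edge
    between two of these would form with [v] a triangle whose maximal clique shares two vertices
    with both cliques. *)
Lemma cliques_at_le2 v : #|cliques_at v| <= 2.
Proof.
rewrite leqNgt; apply/negP=> /card_gt2P[K [L [M [[KA LA MA] [KL LM MK]]]]].
have other A B : A \in cliques_at v -> B \in cliques_at v -> A != B ->
    exists2 a, a \in A & a != v.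
  rewrite !inE => /andP[mA vA] /andP[mB vB] AB.
  have [/subsetP sub|] := boolP (A \subset [set v]); last first.
    by case/subsetPn=> a aA; rewrite inE; exists a.
  case/maxsetP: mA => _ H; case/negP: AB; rewrite eq_sym; apply/eqP/H.
    by case/maxsetP: mB.
  by apply/subsetP=> a /sub/set1P->.
have sep A B a b : A \in cliques_at v -> B \in cliques_at v -> A != B ->
    a \in A -> b \in B -> a != v -> b != v -> a != b /\ ~~ adj a b.
  rewrite !inE => /andP[mA vA] /andP[mB vB] AB aA bB av bv.
  have ne : a != b.
    by apply: contraNneq AB => ab; rewrite (maxclique_unique mA mB av) // ab.
  split=> //; apply: contraNN AB => ab.
  have cab : clique [set v; a; b].
    have va : adj v a by apply: (maxclique_clique mA); rewrite // eq_sym.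
    have vb : adj v b by apply: (maxclique_clique mB); rewrite // eq_sym.
    move=> x y; rewrite !inE.
    by do 2!case/orP=> [/orP[]|] /eqP->; rewrite ?eqxx // adj_sym.
  have [C mC /subsetP sC] := maxclique_extend cab.
  have vC : v \in C by apply: sC; rewrite !inE eqxx.
  have aC : a \in C by apply: sC; rewrite !inE eqxx orbT.
  have bC : b \in C by apply: sC; rewrite !inE eqxx orbT.
  by rewrite (maxclique_unique mA mC av) // (maxclique_unique mB mC bv).
have LK : L != K by rewrite eq_sym.
have KM : K != M by rewrite eq_sym.
have ML : M != L by rewrite eq_sym.
have [a aK av] := other K L KA LA KL.
have [b bL bv] := other L K LA KA LK.
have [c cM cv] := other M K MA KA MK.
have [ab nab] := sep K L a b KA LA KL aK bL av bv.
have [ac nac] := sep K M a c KA MA KM aK cM av cv.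
have [bc nbc] := sep L M b c LA MA LM bL cM bv cv.
have adjv A x : A \in cliques_at v -> x \in A -> x != v -> adj v x.
  rewrite inE => /andP[mA vA] xA xv; apply: (maxclique_clique mA) => //.
  by rewrite eq_sym.
exact: (cf (adjv K a KA aK av) (adjv L b LA bL bv) (adjv M c MA cM cv)).
Qed.

(* The vertices of the root graph are the maximal cliques of [G], together with
   a pendant vertex for each vertex of [G] lying in only one of them; copies
   [inl v] that are not pendant are isolated. *)
Definition ends v : {set G + {set G}} :=
  [set r | match r with
           | inl u => (u == v) && (#|cliques_at v| == 1)
           | inr K => K \in cliques_at v
           end].

Lemma card_ends v : #|ends v| = 2.
Proof.
have [c1|c1] := eqVneq #|cliques_at v| 1.
  have /eqP/cards1P[K KE] := c1.
  have -> : ends v = [set inl v; inr K].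
    apply/setP=> -[u|L]; rewrite !inE /= ?c1 ?andbT ?orbF //.
    by move/setP/(_ L): KE; rewrite !inE.
  by rewrite cards2.
have /eqP/cards2P[K [L [KL E]]] : #|cliques_at v| = 2.
  by apply/eqP; rewrite eqn_leq cliques_at_le2 ltn_neqAle eq_sym c1 cliques_at_gt0.
have -> : ends v = [set inr K; inr L].
  apply/setP=> -[u|M]; rewrite !inE /= ?(negbTE c1) ?andbF //.
  by move/setP/(_ M): E; rewrite !inE.
by rewrite cards2 (inj_eq (@inr_inj _ _)) KL.
Qed.

(** A pendant end determines its vertex; without one there are two distinct maximal cliques, which
    cannot share a second vertex. *)
Lemma ends_inj : injective ends.
Proof.
move=> u v E; apply/eqP; apply: contraT => uv.
have [c1|c1] := eqVneq #|cliques_at v| 1.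
  have : inl v \in ends v by rewrite inE eqxx c1.
  by rewrite -E inE eq_sym (negbTE uv).
have /card_gt1P[K [L [KA LA]]] : 1 < #|cliques_at v|.
  by rewrite ltn_neqAle eq_sym c1 cliques_at_gt0.
have atE M : (M \in cliques_at u) = (M \in cliques_at v).
  by move/setP/(_ (inr M)): E; rewrite !inE.
have := atE K; have := atE L; rewrite KA LA !inE => /andP[mL uL] /andP[mK uK].
move: KA LA; rewrite !inE => /andP[_ vK] /andP[_ vL].
by rewrite (maxclique_unique mK mL uv) ?eqxx.
Qed.

Lemma adj_ends u v : adj u v = (u != v) && (ends u :&: ends v != set0).
Proof.
apply/idP/andP=> [uv|[uv /set0Pn[[w|K]]]].
- split; first by apply: contraTneq uv => ->; rewrite adj_irrefl.
  have [|M mM /subsetP sM] := @maxclique_extend [set u; v].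
    by move=> x y /set2P[]-> /set2P[]->; rewrite ?eqxx // adj_sym.
  by apply/set0Pn; exists (inr M); rewrite !inE mM !sM // !inE eqxx ?orbT.
- by rewrite !inE => /andP[/andP[/eqP-> _] /andP[/eqP vw _]]; rewrite vw eqxx in uv.
- by rewrite !inE => /andP[/andP[mK uK] /andP[_ vK]]; apply: (maxclique_clique mK).
Qed.

Definition root_adj (r s : G + {set G}) :=
  (r != s) && [exists v, ends v == [set r; s]].

Lemma root_adj_sym : symmetric root_adj.
Proof. by move=> r s; rewrite /root_adj eq_sym setUC. Qed.

Lemma root_adj_irrefl : irreflexive root_adj.
Proof. by move=> r; rewrite /root_adj eqxx. Qed.

Definition root := SGraph root_adj_sym root_adj_irrefl.

Lemma mem_edges_root e : (e \in edges root) = [exists v, ends v == e].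
Proof.
rewrite inE; apply/existsP/existsP=> [[r /existsP[s /andP[/andP[_ /existsP[v vE]] /eqP->]]]|].
  by exists v.
case=> v /eqP<-; have /eqP/cards2P[r [s [rs E]]] := card_ends v.
exists r; apply/existsP; exists s; rewrite -E eqxx andbT /adj /= /root_adj rs.
by apply/existsP; exists v; rewrite E.
Qed.

Lemma ends_edge v : ends v \in edges root.
Proof. by rewrite mem_edges_root; apply/existsP; exists v. Qed.

Lemma isomorphic_line_root : isomorphic G (line_graph root).
Proof.
pose f v : line_graph root := exist _ (ends v) (ends_edge v).
have fi : injective f by move=> u v /(congr1 val)/ends_inj.
exists f; last first.
  move=> u v; rewrite /adj /= /line_adj /= (inj_eq fi).
  by rewrite -[RHS]/(adj u v) adj_ends.
apply: inj_card_bij => //; rewrite card_sig.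
rewrite -(card_imset _ ends_inj); apply/subset_leq_card/subsetP=> e eE.
have : e \in edges root by [].
by rewrite mem_edges_root => /existsP[v /eqP<-]; apply: imset_f.
Qed.

Lemma end_shared u v r : u != v -> r \in ends u -> r \in ends v ->
  exists K, [/\ r = inr K, maxclique K, u \in K & v \in K].
Proof.
case: r => [w|K] uv; rewrite !inE.
  by case/andP=> /eqP-> _ /andP[/eqP E _]; rewrite E eqxx in uv.
by case/andP=> mK uK /andP[_ vK]; exists K.
Qed.

(** The edges of a triangle are three pairwise adjacent vertices of [G], contained in one maximal
    clique [N]. Each corner of the triangle is a maximal clique sharing two vertices with [N], so
    the corners coincide. *)
Lemma root_triangle_free : triangle_free root.
Proof.
move=> r s t [/andP[rs /existsP[w1 /eqP E1]] /andP[st /existsP[w2 /eqP E2]]].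
case/andP=> rt /existsP[w3 /eqP E3].
have ne u v z : z \in ends u -> z \notin ends v -> u != v.
  by move=> zu zv; apply: contraNneq zv => <-.
have n13 : w1 != w3.
  by apply: (ne _ _ s); rewrite ?E1 ?E3 !inE ?eqxx ?orbT // negb_or eq_sym rs.
have n12 : w1 != w2.
  by apply: (ne _ _ r); rewrite ?E1 ?E2 !inE ?eqxx ?orbT // negb_or rs.
have n23 : w2 != w3.
  by apply: (ne _ _ s); rewrite ?E2 ?E3 !inE ?eqxx ?orbT // negb_or eq_sym rs.
have [||K [rK mK K1 K3]] := end_shared (r := r) n13; rewrite ?E1 ?E3 ?inE ?eqxx ?orbT //.
have [||L [sL mL L1 L2]] := end_shared (r := s) n12; rewrite ?E1 ?E2 ?inE ?eqxx ?orbT //.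
have [||M [_ mM M2 M3]] := end_shared (r := t) n23; rewrite ?E2 ?E3 ?inE ?eqxx ?orbT //.
have a12 := maxclique_clique mL L1 L2 n12.
have a13 := maxclique_clique mK K1 K3 n13.
have a23 := maxclique_clique mM M2 M3 n23.
have [|N mN /subsetP sN] := @maxclique_extend [set w1; w2; w3].
  move=> x y; rewrite !inE.
  by do 2!case/orP=> [/orP[]|] /eqP->; rewrite ?eqxx // adj_sym.
have N1 : w1 \in N by apply: sN; rewrite !inE eqxx.
have N2 : w2 \in N by apply: sN; rewrite !inE eqxx ?orbT.
have N3 : w3 \in N by apply: sN; rewrite !inE eqxx ?orbT.
have KN := maxclique_unique mK mN n13 K1 K3 N1 N3.
have LN := maxclique_unique mL mN n12 L1 L2 N1 N2.
by move: rs; rewrite rK sL KN LN eqxx.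
Qed.

(* The edges of a cycle of the root graph form a hole of [G], in which a chord
   has at least four neighbours. *)
Lemma root_chordless : chordless_graph root.
Proof.
move=> c [c2 uc cc] [r [s [rc sc /andP[rs /existsP[w /eqP wE]] snr rns]]].
(* [g x] is the vertex of [G] encoding the cycle edge from [x] to its successor; the default [w] is
   not reached for [x] on [c]. *)
pose g x := odflt w [pick v | ends v == [set x; next c x]].
have gE x : x \in c -> ends (g x) = [set x; next c x].
  move=> /(next_cycle cc)/andP[_ /existsP[v vE]]; rewrite /g.
  by case: pickP => [u /eqP//|/(_ v)]; rewrite vE.
have nn x : x \in c -> (next c x != x) && (next c (next c x) != x).
  exact: next_next_neq.
have gi : {in c &, injective g}.
  move=> x y xc yc /(congr1 ends); rewrite !gE // => E.
  have : x \in [set y; next c y] by rewrite -E !inE eqxx.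
  case/set2P=> // xy; have : y \in [set x; next c x] by rewrite E !inE eqxx.
  case/set2P=> // yx; have /andP[_] := nn x xc.
  by rewrite -yx -xy eqxx.
have share x y z : x \in c -> y \in c -> x != y -> z \in ends (g x) -> z \in ends (g y) ->
    adj (g x) (g y).
  move=> xc yc xy zx zy; rewrite adj_ends (contra_neq (gi x y xc yc)) //.
  by apply/set0Pn; exists z; rewrite inE zx.
pose h := map g c.
have uh : uniq h by rewrite map_inj_in_uniq.
have nr := nn r rc; have ns := nn s sc.
have h_hole : is_hole h.
  split; [split=> // | | ].
  - by rewrite size_map.
  - rewrite cycle_map; apply: (sub_in_cycle (P := mem c) (e := frel (next c))).
    + move=> x y xc yc /eqP xy; have /andP[nx _] := nn x xc.
      apply: (share x y y) => //; first by rewrite -xy eq_sym.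
        by rewrite gE // -xy !inE eqxx orbT.
      by rewrite gE // !inE eqxx.
    + exact/allP.
    + exact: cycle_next.
  (* The ends of a chord are not consecutive, so together with their successors they are four
     distinct vertices of the cycle. *)
  - rewrite size_map; have : uniq [:: r; next c r; s; next c s].
      have nrr : r != next c r by rewrite eq_sym; case/andP: nr.
      have nss : s != next c s by rewrite eq_sym; case/andP: ns.
      have nrs : next c r != s by rewrite eq_sym.
      have nrns : next c r != next c s.
        by apply: contraNneq rs => E; rewrite -(prev_next uc r) E prev_next.
      by rewrite /= !inE !negb_or nrr rs rns nrs nrns nss.
    move/uniq_leq_size; apply=> x; rewrite !inE.
    by case/or4P=> /eqP->; rewrite ?mem_next.
  (* Adjacent vertices of [h] encode edges sharing an end, and each way of sharing makes these edges
     equal or consecutive on the cycle. *)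
  - case=> _ [_ [/mapP[x xc ->] /mapP[y yc ->] xy]].
    rewrite !(next_map_in gi) // => yx xny.
    move: xy; rewrite adj_ends !gE // => /andP[nxy /set0Pn[z]].
    rewrite !inE => /andP[/orP[]/eqP-> /orP[]/eqP E].
    + by rewrite E eqxx in nxy.
    + by rewrite E eqxx in xny.
    + by rewrite -E eqxx in yx.
    + by move: nxy; rewrite -(prev_next uc x) E prev_next // eqxx.
have wh : w \notin h.
  apply/mapP=> -[x xc wx]; have := gE x xc; rewrite -wx wE => E.
  have : r \in [set x; next c x] by rewrite -E !inE eqxx.
  have : s \in [set x; next c x] by rewrite -E !inE eqxx orbT.
  by case/set2P=> Es /set2P[] Er; move: rs snr rns; rewrite Es Er eqxx.
have wadj x z : x \in c -> z \in ends w -> z \in ends (g x) -> adj w (g x).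
  move=> xc zw zx; rewrite adj_ends; apply/andP; split.
    by apply: contraNneq wh => ->; apply: map_f.
  by apply/set0Pn; exists z; rewrite inE zw.
have pc : prev c r \in c by rewrite mem_prev.
have np : next c (prev c r) = r by rewrite next_prev.
(* Three neighbours of [w] suffice: the cycle edges leaving [r], leaving [s], and entering [r]. *)
apply: (wheel_free_hole wf (w := w) (t := map g [:: r; s; prev c r]) h_hole) => //.
- rewrite map_inj_in_uniq => [|x y]; last first.
    by rewrite !inE => /or3P[]/eqP-> /or3P[]/eqP->; apply: gi.
  rewrite /= !inE negb_or rs andbT /=; apply/andP; split.
    have /andP[+ _] := nn _ pc; by rewrite np.
  by apply: contraNneq rns => ->; rewrite np.
- by move=> _ /mapP[x + ->]; rewrite !inE => /or3P[]/eqP->; apply: map_f.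
- rewrite /= (wadj r r) ?(wadj s s) ?(wadj _ r pc) ?gE ?wE ?np ?inE ?eqxx ?orbT //.
Qed.

End RootGraph.

(** * Conclusion: splitting on the existence of a clique cutset *)

Lemma no_clique_cutset_connected (G : sgraph) :
  ~~ [exists S : {set G}, cliqueb S &&
        [exists x : induced (~: S), exists y, ~~ connect adj x y]] ->
  clique_connected G.
Proof.
move=> nS S x y cS xS yS.
have xC : x \in ~: S by rewrite inE.
have yC : y \in ~: S by rewrite inE.
have : connect adj (exist _ x xC : induced (~: S)) (exist _ y yC).
  apply: contraNT nS => nc; apply/existsP; exists S; apply/andP; split.
    exact/cliqueP.
  by apply/existsP; exists (exist _ x xC); apply/existsP; exists (exist _ y yC).
case/connectP=> p /walk_ipath[q [iq lq _]] yE; exists (map val q); split.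
- by move: iq; rewrite -ipath_val.
- by rewrite -[x]/(val (exist _ x xC : induced (~: S))) last_map lq -yE.
- by move=> _ /mapP[z _ ->]; have := valP z; rewrite inE.
Qed.

Theorem theorem2p5 (G : sgraph) :
  free_of is_theta G -> free_of is_wheel G -> free_of is_pyramid G ->
  (exists R : sgraph,
     [/\ triangle_free R, chordless_graph R & isomorphic G (line_graph R)])
  \/ (exists S : {set G}, clique_cutset S).
Proof.
move=> tf wf pf.
(* Over a finite graph the existence of a clique cutset is a boolean, so the case split is
   constructive. *)
have [/existsP[S /andP[/cliqueP cS /existsP[x /existsP[y nxy]]]]|] :=
    boolP [exists S : {set G}, cliqueb S &&
             [exists x : induced (~: S), exists y, ~~ connect adj x y]].
  by right; exists S; split=> //; exists x, y.
move/no_clique_cutset_connected=> cc; left.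
have df := wheel_free_diamond_free wf cc; have cf := claw_contra tf wf pf cc.
exists (root G); split.
- exact: root_triangle_free.
- exact: root_chordless.
- exact: isomorphic_line_root.
Qed.
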